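(* Let $G$ be a group with a finite generating set $S$ and with the Morse local-to-global property. Let $H<G$ be a stable subgroup that is infinite and of infinite index. Then the growth rate of $H$ with respect to $S$ is strictly smaller than the growth rate of $G$ with respect to $S$, i.e. $\lambda_{H,S}<\lambda_{G,S}$.
   Context: A $(\lambda,\kappa)$-quasi-geodesic ($\lambda\ge1,\kappa\ge0$) in a geodesic metric space $X$ is a map $\gamma:I\to X$, $I\subseteq\mathbb R$ a closed interval, with $\frac1\lambda|s-t|-\kappa\le d(\gamma(s),\gamma(t))\le\lambda|s-t|+\kappa$; quasi-geodesics are taken to be continuous. A Morse gauge is a function $M:\mathbb R_{\ge1}\times\mathbb R_{\ge0}\to\mathbb R_{\ge0}$. A quasi-geodesic $\gamma$ is $M$-Morse if every $(Q,q)$-quasi-geodesic with endpoints $\gamma(s),\gamma(t)$ is contained in the closed $M(Q,q)$-neighbourhood of $\gamma|_{[s,t]}$. A path is $L$-locally (P) if each of its restrictions to a subinterval of length at most $L$ has property (P). MLTG property of $X$: for every quasi-geodesic pair $(\lambda,\kappa)$ and Morse gauge $M$ there exist a scale $L$, a quasi-geodesic pair $(\lambda',\kappa')$ and a Morse gauge $M'$ such that every path that is $L$-locally an $M$-Morse $(\lambda,\kappa)$-quasi-geodesic is globally an $M'$-Morse $(\lambda',\kappa')$-quasi-geodesic. The property is a quasi-isometry invariant; a finitely generated group has it if its Cayley graph with respect to some (equivalently every) finite generating set does. Stable subgroup: $H\le G$ is stable if there exist a Morse gauge $M$ and $R\ge0$ such that in $\mathrm{Cay}(G,S)$ every two points of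 $H$ can be joined by an $M$-Morse geodesic contained in the $R$-neighbourhood of $H$ (independent of the finite generating set $S$). Growth: for $H\le G$, $\mathrm{Growth}_{H,S}(n)$ is the number of elements of $H$ at distance at most $n$ from the identity in $\mathrm{Cay}(G,S)$, and the growth rate is $\lambda_{H,S}=\limsup_{n\to\infty}\sqrt[n]{\mathrm{Growth}_{H,S}(n)}$. *)

(* Defs.v *)
From HB Require Import structures.
From mathcomp Require Import all_boot all_order all_algebra.
From mathcomp Require Import finmap.
From mathcomp Require Import all_classical all_reals all_analysis.
Set Implicit Arguments.
Unset Strict Implicit.
Unset Printing Implicit Defensive.
Import Order.TTheory GRing.Theory Num.Theory.
Import numFieldNormedType.Exports.
Local Open Scope classical_set_scope.
Local Open Scope ring_scope.

Section QuasiGeodesics.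
Context {R : realType} {X : metricType R}.
Implicit Types (I : set R) (gamma sigma : R -> X) (M : R -> R -> R).

(* A path is a map on a nonempty closed interval I, possibly unbounded; it is
   represented by I and a total map R -> X whose values off I are irrelevant. *)
Definition closed_interval I := [/\ I !=set0, is_interval I & closed I].

Definition is_path I gamma :=
  closed_interval I /\ {within I, continuous gamma}.

Definition quasi_geodesic (lam kap : R) I gamma :=
  is_path I gamma /\
  forall s t, I s -> I t ->
    lam^-1 * `|s - t| - kap <= mdist (gamma s) (gamma t)
                            <= lam * `|s - t| + kap.

Definition geodesic I gamma :=
  is_path I gamma /\
  forall s t, I s -> I t -> mdist (gamma s) (gamma t) = `|s - t|.

Definition closed_nbhd (A : set X) (r : R) : set X :=
  [set x | (ereal_inf [set (mdist x y)%:E | y in A] <= r%:E)%E].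

(* M stands for a function on R_{>=1} x R_{>=0}: only its values there matter. *)
Definition morse_gauge M := forall Q q : R, 1 <= Q -> 0 <= q -> 0 <= M Q q.

Definition morse M I gamma :=
  forall s t, I s -> I t -> s <= t ->
  forall Q q : R, 1 <= Q -> 0 <= q ->
  forall (a b : R) sigma, a <= b -> quasi_geodesic Q q `[a, b] sigma ->
    sigma a = gamma s -> sigma b = gamma t ->
    sigma @` `[a, b] `<=` closed_nbhd (gamma @` `[s, t]) (M Q q).

Definition morse_quasi_geodesic M lam kap I gamma :=
  quasi_geodesic lam kap I gamma /\ morse M I gamma.

Definition locally (L : R) (P : set R -> (R -> X) -> Prop) I gamma :=
  forall a b, I a -> I b -> a <= b -> b - a <= L -> P `[a, b]%classic gamma.

End QuasiGeodesics.

Definition MLTG (R : realType) (X : metricType R) : Prop :=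
  forall (lam kap : R) (M : R -> R -> R),
    1 <= lam -> 0 <= kap -> morse_gauge M ->
  exists (L lam' kap' : R) (M' : R -> R -> R),
    [/\ 0 <= L, 1 <= lam', 0 <= kap' & morse_gauge M'] /\
    forall (I : set R) (gamma : R -> X), is_path I gamma ->
      locally L (morse_quasi_geodesic M lam kap) I gamma ->
      morse_quasi_geodesic M' lam' kap' I gamma.

Record finGenSet (G : groupType) := FinGenSet {
  gens :> set G ;
  gens_finite : finite_set gens ;
  gens_generate : forall K : groupClosed G,
    {subset gens <= K} -> forall g, g \in K }.

Section Cayley.
Context (R : realType) (G : groupType) (S : finGenSet G).
Implicit Types (u v : G) (t : R).

Local Open Scope group_scope.

(* u and v are equal or are the endpoints of an edge. Orientations, labels,
   multiple edges and loops are forgotten. *)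
Definition cay_edge u v :=
  u = v \/ exists2 s, gens S s & v = u * s \/ u = v * s.

Local Close Scope group_scope.

(* Barycentric coordinates of the point at distance t from u on the edge uv. *)
Definition edge_point u v t : G -> R :=
  fun g => (1 - t) *+ (g == u) + t *+ (g == v).

Record cayley := CayPoint {
  bary : G -> R ;
  _ : exists u v t, [/\ cay_edge u v, 0 <= t <= 1 & bary = edge_point u v t] }.

HB.instance Definition _ := gen_eqMixin cayley.
HB.instance Definition _ := gen_choiceMixin cayley.

Lemma bary_inj x y : bary x = bary y -> x = y.
Proof.
case: x y => [x px] [y py] /= xy; move: px py; rewrite xy => px py.
by congr CayPoint; exact: Prop_irrelevance.
Qed.

Lemma baryP x :
  exists u v t, [/\ cay_edge u v, 0 <= t <= 1 & bary x = edge_point u v t].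
Proof. by case: x. Qed.

Fact vertex_subproof g : exists u v t,
  [/\ cay_edge u v, 0 <= t <= 1 & edge_point g g 0 = edge_point u v t].
Proof. by exists g, g, 0; rewrite lexx ler01; split=> //; left. Qed.

Definition vertex g : cayley := CayPoint (vertex_subproof g).

(* cay_chain x y l: some chain of total length l joins x to y, each step being
   a segment inside a single closed edge of length 1. The infimum of these
   lengths is the path metric on the geometric realization. *)
Inductive cay_chain : cayley -> cayley -> R -> Prop :=
| cay_chain0 x : cay_chain x x 0
| cay_chainS x y z u v t t' l :
    cay_edge u v -> 0 <= t <= 1 -> 0 <= t' <= 1 ->
    bary x = edge_point u v t -> bary y = edge_point u v t' ->
    cay_chain y z l -> cay_chain x z (`|t - t'| + l).

Definition cay_dist x y : R := inf [set l | cay_chain x y l].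

Lemma cay_chain_cat x y z l l' :
  cay_chain x y l -> cay_chain y z l' -> cay_chain x z (l + l').
Proof.
elim=> [w|w w' w'' u v t t' k e t1 t1' ew ew' _ IH] c; first by rewrite add0r.
by rewrite -addrA; apply: (cay_chainS e t1 t1' ew ew'); exact: IH.
Qed.

Lemma cay_chain_sym x y l : cay_chain x y l -> cay_chain y x l.
Proof.
elim=> [w|w w' w'' u v t t' k e t1 t1' ew ew' _ IH]; first exact: cay_chain0.
rewrite addrC; apply: (cay_chain_cat IH).
by rewrite -[X in cay_chain _ _ X]addr0 distrC;
   apply: (cay_chainS e t1' t1 ew' ew (cay_chain0 w)).
Qed.

Lemma cay_chain_bary x y l g : cay_chain x y l -> `|bary x g - bary y g| <= l.
Proof.
elim=> [w|w w' w'' u v t t' k e t1 t1' ew ew' _ IH]; first by rewrite subrr normr0.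
have -> : bary w g - bary w'' g = (bary w g - bary w' g) + (bary w' g - bary w'' g).
  by rewrite addrA subrK.
apply: (le_trans (ler_normD _ _)); apply: lerD => //.
rewrite ew ew' /edge_point.
case: (g == u); case: (g == v); rewrite ?mulr1n ?mulr0n ?addr0 ?add0r.
- by rewrite !subrK subrr normr0.
- by rewrite opprB addrC addrA subrK distrC.
- by [].
- by rewrite oppr0 normr0.
Qed.

Definition cay_conn x y := exists l, cay_chain x y l.

Lemma cay_conn_trans y x z : cay_conn x y -> cay_conn y z -> cay_conn x z.
Proof. by move=> [l c] [l' c']; exists (l + l'); exact: cay_chain_cat c'. Qed.

Lemma cay_conn_sym x y : cay_conn x y -> cay_conn y x.
Proof. by move=> [l c]; exists l; exact: cay_chain_sym. Qed.

Lemma edge_point1 u v : edge_point u v 1 = edge_point v v 0.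
Proof.
apply/funext => g; rewrite /edge_point subrr subr0.
by case: (g == u); case: (g == v); rewrite /= ?mulr1n ?mulr0n ?addr0 ?add0r.
Qed.

Lemma edge_point0 u v : edge_point u v 0 = edge_point u u 0.
Proof.
by apply/funext => g; rewrite /edge_point !mul0rn.
Qed.

Lemma cay_conn_edge u v : cay_edge u v -> cay_conn (vertex u) (vertex v).
Proof.
move=> e; exists (`|0 - 1| + 0).
apply: (cay_chainS (y := vertex v) e) => /=; rewrite ?lexx ?ler01 //.
- by rewrite [RHS]edge_point0.
- by rewrite edge_point1.
- exact: cay_chain0.
Qed.

Definition conn_translate : {pred G} :=
  fun k => `[< forall g, cay_conn (vertex g) (vertex (g * k)%g) >].

Fact conn_translateM : mulg_closed conn_translate.
Proof.
move=> h k /asboolP ch /asboolP ck; apply/asboolP => g.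
by rewrite mulgA; exact: cay_conn_trans (ch g) (ck _).
Qed.

Fact conn_translate1 : 1%g \in conn_translate.
Proof. by apply/asboolP => g; rewrite mulg1; exists 0; exact: cay_chain0. Qed.

Fact conn_translateV : invg_closed conn_translate.
Proof.
move=> k /asboolP ck; apply/asboolP => g.
by have := ck (g * k^-1)%g; rewrite mulgVK; exact: cay_conn_sym.
Qed.

HB.instance Definition _ := isMulClosed.Build G conn_translate conn_translateM.
HB.instance Definition _ := isMul1Closed.Build G conn_translate conn_translate1.
HB.instance Definition _ := isInvClosed.Build G conn_translate conn_translateV.

Lemma cay_conn_vertex u v : cay_conn (vertex u) (vertex v).
Proof.
have : (u^-1 * v)%g \in conn_translate.
  apply: (@gens_generate _ S) => s /set_mem Ss; apply/asboolP => g.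
  by apply: cay_conn_edge; right; exists s => //; left.
by move=> /asboolP /(_ u); rewrite mulVKg.
Qed.

Lemma cay_connected x y : cay_conn x y.
Proof.
have H z : exists u, cay_conn z (vertex u).
  have [u [v [t [e t01 ez]]]] := baryP z; exists u; exists (`|t - 0| + 0).
  apply: (cay_chainS (y := vertex u) e t01) => //=; rewrite ?lexx ?ler01 //.
    by rewrite [RHS]edge_point0.
  exact: cay_chain0.
have [u xu] := H x; have [v yv] := H y.
apply: (cay_conn_trans xu); apply: (cay_conn_trans (cay_conn_vertex u v)).
exact: cay_conn_sym.
Qed.

Lemma cay_chain_ge0 x y l : cay_chain x y l -> 0 <= l.
Proof. by move=> c; exact: le_trans (cay_chain_bary 1%g c). Qed.

Lemma cay_dist_le x y l : cay_chain x y l -> cay_dist x y <= l.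
Proof.
by move=> c; apply: ge_inf => //; exists 0 => k; exact: cay_chain_ge0.
Qed.

Lemma cay_dist_ge x y l :
  (forall k, cay_chain x y k -> l <= k) -> l <= cay_dist x y.
Proof. by move=> H; apply: lb_le_inf; [exact: cay_connected|exact: H]. Qed.

Fact cay_distxx x : cay_dist x x = 0.
Proof.
apply/eqP; rewrite eq_le cay_dist_le ?cay_dist_ge //; last exact: cay_chain0.
by move=> k; exact: cay_chain_ge0.
Qed.

Fact cay_dist_positivity x y : cay_dist x y = 0 -> x = y.
Proof.
move=> d0; apply: bary_inj; apply/funext => g; apply/eqP.
rewrite -subr_eq0 -normr_le0 -d0; apply: cay_dist_ge => k; exact: cay_chain_bary.
Qed.

Fact cay_dist_sym x y : cay_dist x y = cay_dist y x.
Proof.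
by congr inf; apply/seteqP; split=> l; exact: cay_chain_sym.
Qed.

Fact cay_dist_triangle y x z : cay_dist x z <= cay_dist x y + cay_dist y z.
Proof.
rewrite -lerBlDr; apply: cay_dist_ge => k ck.
rewrite lerBlDr -lerBlDl; apply: cay_dist_ge => l cl.
by rewrite lerBlDl; apply: cay_dist_le; exact: cay_chain_cat cl.
Qed.

HB.instance Definition _ := isMetric.Build R cayley
  cay_distxx cay_dist_positivity cay_dist_sym cay_dist_triangle.

End Cayley.

Definition has_MLTG (R : realType) (G : groupType) : Prop :=
  exists T : finGenSet G, MLTG (cayley R T).

Section StableGrowth.
Context (R : realType) (G : groupType) (S : finGenSet G).
Local Open Scope group_scope.

Definition stable (H : groupClosed G) : Prop :=
  exists (M : R -> R -> R) (r : R), [/\ morse_gauge M, (0 <= r)%R &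
    forall h k : G, h \in H -> k \in H ->
    exists (b : R) (gamma : R -> cayley R S),
      [/\ (0 <= b)%R, geodesic `[0%R, b] gamma, morse M `[0%R, b] gamma,
          gamma 0%R = vertex R S h /\ gamma b = vertex R S k &
          gamma @` `[0%R, b] `<=` closed_nbhd (vertex R S @` [set` H]) r]].

(* fset_set is the counted set itself: balls are finite because S is. *)
Definition growth (A : set G) (n : nat) : nat :=
  #|` fset_set (A `&` [set g |
        (mdist (vertex R S 1%g) (vertex R S g) <= n%:R)%R])|.

(* The limsup is taken in \bar R; it is finite, as growth A n <= (2 #|S| + 1)^n. *)
Definition growth_rate (A : set G) : \bar R :=
  limn_esup (fun n : nat => ((growth A n)%:R `^ (n%:R^-1)%R)%:E).

Definition infinite_index (H : groupClosed G) : Prop :=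
  infinite_set [set [set g * h | h in [set` H]] | g in [set: G]].

End StableGrowth.

(* Main.v *)
(* Words h1 g h2 g ... hk g, with letters in H and a suitable fixed g, are used to
   produce exponentially more elements in G than in H.

   Choice of g. If every intersection of H with g H g^-1 were infinite, the Morse
   property would make any two cosets of H uniformly close. Taking among finitely
   many cosets the one whose projection of 1 is farthest from 1, that projection
   would be uniformly close to all of them (a coarse Helly property), which bounds
   the index of H. So some intersection is finite, and then H and g H stay within
   any given distance of each other only in a bounded region.

   Injectivity. For such a g, a path in H followed by a path in h g H is a uniformly
   Morse quasi-geodesic, so by the local-to-global property the path of a word with
   long letters is one too. Two words with the same value thus fellow-travel, and
   their first letters are uniformly close: on a separated set of letters, words
   inject into G.

   Counting. Quasi-convexity makes the growth of H submultiplicative up to a shift,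
   so with l the growth rate of H the series of l^-|h| over H diverges. A finite
   separated set of letters then has total weight > 1 for the weight z^(|h| + |g|)
   with some z < 1/l, so the weights z^|x| are not summable over G, whereas they would
   be if the growth rate of G were at most l. *)
Require Import Defs.
From HB Require Import structures.
From mathcomp Require Import all_boot all_order all_algebra.
From mathcomp Require Import finmap.
From mathcomp Require Import all_classical all_reals all_analysis.
From mathcomp Require Import zify ring lra.
Set Implicit Arguments.
Unset Strict Implicit.
Unset Printing Implicit Defensive.
Import Order.TTheory GRing.Theory Num.Theory.
Import numFieldNormedType.Exports.
Local Open Scope classical_set_scope.
Local Open Scope group_scope.
Local Open Scope nat_scope.

(** * Word metrics *)

Section WordMetric.
Context (G : groupType) (S : finGenSet G).
Implicit Types (u v w g : G).

Lemma cay_edge_refl u : cay_edge S u u. Proof. by left. Qed.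

Lemma cay_edge_sym u v : cay_edge S u v -> cay_edge S v u.
Proof.
by case=> [->|[s Ss []e]]; [left|right; exists s => //; right
  |right; exists s => //; left].
Qed.

Lemma cay_edge_mull g u v : cay_edge S u v -> cay_edge S (g * u)%g (g * v)%g.
Proof.
by case=> [->|[s Ss []->]]; [left|right; exists s => //; left; rewrite mulgA
  |right; exists s => //; right; rewrite mulgA].
Qed.

Fixpoint reach n u v : Prop :=
  if n is n'.+1 then exists2 w, reach n' u w & cay_edge S w v else u = v.

Lemma reach_cat n m u w v : reach n u w -> reach m w v -> reach (n + m) u v.
Proof.
move=> nuw; elim: m v => [|m IH] v /=; first by move=> <-; rewrite addn0.
by case=> x /IH + xv; rewrite addnS => ux; exists x.
Qed.

Lemma reach_sym n u v : reach n u v -> reach n v u.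
Proof.
elim: n u v => [//|n IH] u v /= [w /IH wu wv].
by apply: (@reach_cat 1 n _ w) wu; exists v => //; exact: cay_edge_sym.
Qed.

Lemma reach_mull g n u v : reach n u v -> reach n (g * u)%g (g * v)%g.
Proof.
elim: n v => [|n IH] v /=; first by move->.
by case=> w /IH gw e; exists (g * w)%g => //; exact: cay_edge_mull.
Qed.

Lemma reach_leq n m u v : n <= m -> reach n u v -> reach m u v.
Proof.
move=> nm r; rewrite -(subnKC nm); apply: reach_cat r _.
by elim: (m - n) => [//|k IH] /=; exists v => //; exact: cay_edge_refl.
Qed.

Lemma reach_path n u v : reach n u v ->
  exists x : nat -> G, [/\ x 0 = u, x n = v &
    forall i j, i <= j <= n -> reach (j - i) (x i) (x j)].
Proof.
elim: n v => [|n IH] v /=.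
  by move=> ->; exists (fun=> v); split=> // i j _; apply: (@reach_leq 0).
case=> w /IH [x [x0 xn xr]] wv; exists (fun i => if i <= n then x i else v).
rewrite leq0n ltnn; split=> // i j /andP[ij jn].
have [jn'|nj] := leqP j n.
  by rewrite (leq_trans ij jn'); apply: xr; rewrite ij.
have -> : j = n.+1 by apply/eqP; rewrite eqn_leq jn nj.
have [iN|ni] := leqP i n.
  by rewrite subSn //; exists w => //; rewrite -xn; apply: xr; rewrite iN leqnn.
by apply: (@reach_leq 0).
Qed.

(** Generation of G is available only as an induction over subgroups, so connectedness is obtained
    by showing that the right translations of bounded displacement form a subgroup containing the
    generators. *)
Definition translatable : {pred G} :=
  fun k => `[< exists n, forall g, reach n g (g * k)%g >].

Fact translatableM : mulg_closed translatable.
Proof.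
move=> h k /asboolP[n ch] /asboolP[m ck]; apply/asboolP; exists (n + m) => g.
by rewrite mulgA; exact: reach_cat (ch g) (ck _).
Qed.

Fact translatable1 : 1%g \in translatable.
Proof. by apply/asboolP; exists 0 => g; rewrite mulg1. Qed.

Fact translatableV : invg_closed translatable.
Proof.
move=> k /asboolP[n ck]; apply/asboolP; exists n => g.
by have := ck (g * k^-1)%g; rewrite mulgVK; exact: reach_sym.
Qed.

HB.instance Definition _ := isMulClosed.Build G translatable translatableM.
HB.instance Definition _ := isMul1Closed.Build G translatable translatable1.
HB.instance Definition _ := isInvClosed.Build G translatable translatableV.

Lemma reach_ex u v : exists n, `[< reach n u v >].
Proof.
have : (u^-1 * v)%g \in translatable.
  apply: (@gens_generate _ S) => s /set_mem Ss; apply/asboolP; exists 1 => g.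
  by exists g => //; right; exists s => //; left.
by move=> /asboolP[n /(_ u)]; rewrite mulVKg => r; exists n; apply/asboolP.
Qed.

Definition wdist u v : nat := ex_minn (reach_ex u v).

Lemma wdist_leP u v n : reflect (reach n u v) (wdist u v <= n).
Proof.
rewrite /wdist; case: ex_minnP => m /asboolP mr mmin.
by apply: (iffP idP) => [mn|/asboolP/mmin//]; exact: reach_leq mr.
Qed.

Lemma wdist_reach u v : reach (wdist u v) u v.
Proof. exact/wdist_leP. Qed.

Lemma wdistxx u : wdist u u = 0.
Proof. by apply/eqP; rewrite -leqn0; apply/wdist_leP. Qed.

Lemma wdist_sym u v : wdist u v = wdist v u.
Proof.
by apply/eqP; rewrite eqn_leq; apply/andP; split; apply/wdist_leP;
  apply: reach_sym; exact: wdist_reach.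
Qed.

Lemma wdist_triangle w u v : wdist u v <= wdist u w + wdist w v.
Proof. by apply/wdist_leP; apply: reach_cat; exact: wdist_reach. Qed.

Lemma wdist_mull g u v : wdist (g * u)%g (g * v)%g = wdist u v.
Proof.
apply/eqP; rewrite eqn_leq; apply/andP; split; apply/wdist_leP.
  by apply: reach_mull; exact: wdist_reach.
by have := reach_mull g^-1 (wdist_reach (g * u)%g (g * v)%g); rewrite !mulKg.
Qed.

Lemma wdist_geodesic u v : exists x : nat -> G,
  [/\ x 0 = u, x (wdist u v) = v &
   forall i j, i <= j <= wdist u v -> wdist (x i) (x j) = j - i].
Proof.
have [x [x0 xn xr]] := reach_path (wdist_reach u v); exists x; split=> // i j.
move=> /andP[ij jn].
have /wdist_leP : reach (i - 0) (x 0) (x i) by apply: xr; lia.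
have /wdist_leP : reach (j - i) (x i) (x j) by apply: xr; lia.
have /wdist_leP : reach (wdist u v - j) (x j) (x (wdist u v)) by apply: xr; lia.
have := wdist_triangle (x i) u v; have := wdist_triangle (x j) (x i) v.
rewrite x0 xn; lia.
Qed.

Definition wlen g := wdist 1%g g.

Lemma wdistE u v : wdist u v = wlen (u^-1 * v)%g.
Proof. by rewrite /wlen -(wdist_mull u^-1) mulVg. Qed.

Lemma wdist_mulr u g : wdist u (u * g)%g = wlen g.
Proof. by rewrite wdistE mulKg. Qed.

Lemma wdist_mull1 u g : wdist (u * g)%g u = wlen g.
Proof. by rewrite wdist_sym wdist_mulr. Qed.

Lemma wlenM u v : wlen (u * v)%g <= wlen u + wlen v.
Proof. by rewrite -(wdist_mulr u v); exact: wdist_triangle. Qed.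

Lemma finite_ball n : finite_set [set g | wlen g <= n].
Proof.
elim: n => [|n IH].
  apply: (sub_finite_set _ (finite_set1 1%g)) => g /= /wdist_leP //=.
pose E := 1%g |` (gens S `|` [set s^-1%g | s in gens S]).
have Ef : finite_set E.
  by rewrite !finite_setU; split; [exact: finite_set1|split;
    [exact: gens_finite|apply: finite_image; exact: gens_finite]].
apply: (sub_finite_set _ (finite_image2 (fun x y => x * y)%g IH Ef)).
move=> g /= /wdist_leP /= [w /wdist_leP wn].
case=> [<-|[s Ss [->|e]]]; exists w => //.
- by exists 1%g; [left|rewrite mulg1].
- by exists s => //; right; left.
- by exists s^-1%g; [right; right; exists s|rewrite e mulgK].
Qed.

End WordMetric.

(** * Coarse paths *)

Section CoarsePaths.
Context (G : groupType) (S : finGenSet G).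
Implicit Types (x y z : nat -> G) (N : nat -> nat).
Local Notation d := (wdist S).

(* Consecutive points may be far apart: no continuity is imposed, so changing the
   generating set only changes the constant. *)
Definition qgeod (c i j : nat) x := forall p q, i <= p -> p <= q -> q <= j ->
  d (x p) (x q) <= c * (q - p) /\ q - p <= c * (d (x p) (x q)).+1.

(** Discrete counterpart of [morse]. One constant c plays the role of the pair (Q, q), so the gauge
    is a function of one variable. *)
Definition dmorse N (i j : nat) x := forall p q, i <= p -> p <= q -> q <= j ->
  forall c m y, qgeod c 0 m y -> y 0 = x p -> y m = x q ->
  forall l, l <= m -> exists2 k, p <= k <= q & d (y l) (x k) <= N c.

(** At the junction the value is [y 0], and [x n] is dropped, so the two paths need not match
    there. *)
Definition catp x n y i := if i < n then x i else y (i - n).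

Lemma qgeod_sub c i j i' j' x : i <= i' -> j' <= j ->
  qgeod c i j x -> qgeod c i' j' x.
Proof. by move=> ii jj qx p q ip pq qj; apply: qx; lia. Qed.

Lemma dmorse_sub N i j i' j' x : i <= i' -> j' <= j ->
  dmorse N i j x -> dmorse N i' j' x.
Proof. by move=> ii jj mx p q ip pq qj; apply: mx; lia. Qed.

Lemma qgeod_ext c i j x y : (forall k, i <= k <= j -> x k = y k) ->
  qgeod c i j x -> qgeod c i j y.
Proof. by move=> xy qx p q ip pq qj; rewrite -!xy; [exact: qx|lia..]. Qed.

Lemma dmorse_ext N i j x y : (forall k, i <= k <= j -> x k = y k) ->
  dmorse N i j x -> dmorse N i j y.
Proof.
move=> xy mx p q ip pq qj c m z qz; rewrite -!xy; [|lia..] => z0 zm l lm.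
have [k kpq dk] := mx _ _ ip pq qj _ _ _ qz z0 zm _ lm.
by exists k => //; rewrite -xy //; lia.
Qed.

Lemma qgeod_le c c' i j x : c <= c' -> qgeod c i j x -> qgeod c' i j x.
Proof.
move=> cc qx p q ip pq qj; have [le ge] := qx p q ip pq qj.
by split; [apply: leq_trans le _|apply: leq_trans ge _]; rewrite leq_mul2r cc orbT.
Qed.

Lemma dmorse_le N N' i j x : (forall c, N c <= N' c) ->
  dmorse N i j x -> dmorse N' i j x.
Proof.
move=> NN mx p q ip pq qj c m y qy y0 ym l lm.
have [k kpq dk] := mx _ _ ip pq qj _ _ _ qy y0 ym _ lm.
by exists k => //; apply: leq_trans (NN c).
Qed.

Lemma qgeod_shift c k i j x :
  qgeod c (k + i) (k + j) x <-> qgeod c i j (fun t => x (k + t)).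
Proof.
split=> qx p q ip pq qj.
  by have := qx (k + p) (k + q); rewrite subnDl; apply; lia.
have := qx (p - k) (q - k); rewrite !subnKC; [|lia..].
by have -> : q - k - (p - k) = q - p; [lia|apply; lia].
Qed.

Lemma dmorse_shift N k i j x :
  dmorse N (k + i) (k + j) x <-> dmorse N i j (fun t => x (k + t)).
Proof.
split=> mx p q ip pq qj c m y qy y0 ym l lm.
  have [|||t tpq dt] := mx (k + p) (k + q) _ _ _ _ _ _ qy y0 ym l lm; [lia..|].
  by exists (t - k); [lia|rewrite subnKC //; lia].
have [|||||t tpq dt] := mx (p - k) (q - k) _ _ _ _ _ _ qy _ _ l lm; [lia..| | |].
- by rewrite subnKC //; lia.
- by rewrite subnKC //; lia.
- by exists (k + t) => //; lia.
Qed.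

Lemma qgeod_mull g c i j x :
  qgeod c i j x -> qgeod c i j (fun t => g * x t)%g.
Proof. by move=> qx p q ip pq qj; rewrite wdist_mull; exact: qx. Qed.

Lemma dmorse_mull g N i j x :
  dmorse N i j x -> dmorse N i j (fun t => g * x t)%g.
Proof.
move=> mx p q ip pq qj c m y qy y0 ym l lm.
have [||k kpq dk] := mx p q ip pq qj c m _ (qgeod_mull g^-1%g qy) _ _ l lm.
- by rewrite y0 mulKg.
- by rewrite ym mulKg.
- by exists k => //; rewrite -(wdist_mull _ g^-1%g) mulKg.
Qed.

Lemma qgeod_rev c m x : qgeod c 0 m x -> qgeod c 0 m (fun t => x (m - t)).
Proof.
move=> qx p q _ pq qm; rewrite wdist_sym.
have := qx (m - q) (m - p); have -> : m - p - (m - q) = q - p by lia.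
by apply; lia.
Qed.

Definition pert_const e c := c * (2 * e).+1 + 2 * e.

Lemma qgeod_pert e c i j x y : (forall k, i <= k <= j -> d (x k) (y k) <= e) ->
  qgeod c i j x -> qgeod (pert_const e c) i j y.
Proof.
move=> xy qx p q ip pq qj; have [le ge] := qx p q ip pq qj.
have xyp : d (x p) (y p) <= e by apply: xy; lia.
have xyq : d (x q) (y q) <= e by apply: xy; lia.
have t1 := wdist_triangle S (x p) (y p) (y q).
have t2 := wdist_triangle S (x q) (x p) (y q).
have t3 := wdist_triangle S (y p) (x p) (x q).
have t4 := wdist_triangle S (y q) (y p) (x q).
have s1 := wdist_sym S (x p) (y p); have s2 := wdist_sym S (x q) (y q).
rewrite /pert_const; split.
  have [->|pq'] := eqVneq p q; first by rewrite wdistxx.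
  have : d (y p) (y q) <= c * (q - p) + 2 * e by lia.
  have : 0 < q - p by lia.
  by move: (q - p) (d _ _) => t D; nia.
have : d (x p) (x q) <= d (y p) (y q) + 2 * e by lia.
by move: ge {le xyp xyq t1 t2 t3 t4 s1 s2}; move: (q - p) (d (x p) (x q)) (d (y p) (y q)) => t D D'; nia.
Qed.

Lemma catp_lt x n y i : i < n -> catp x n y i = x i.
Proof. by rewrite /catp => ->. Qed.

Lemma catp_ge x n y i : n <= i -> catp x n y i = y (i - n).
Proof. by rewrite /catp ltnNge => ->. Qed.

Lemma catp_le x n y i : i <= n -> x n = y 0 -> catp x n y i = x i.
Proof.
rewrite leq_eqVlt => /orP[/eqP-> xy|/catp_lt//].
by rewrite catp_ge // subnn.
Qed.

Lemma catpD x n y i : catp x n y (n + i) = y i.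
Proof. by rewrite catp_ge ?leq_addr // addnC addnK. Qed.

Lemma qgeod_cat c x n y m : qgeod c 0 n x -> qgeod c 0 m y ->
  (forall p q, p < n -> q <= m -> d (x p) (y q) <= c * (n - p + q) /\
     n - p + q <= c * (d (x p) (y q)).+1) ->
  qgeod c 0 (n + m) (catp x n y).
Proof.
move=> qx qy xy p q _ pq qnm.
have [qn|nq] := ltnP q n; first by rewrite !catp_lt //; [apply: qx|]; lia.
rewrite (catp_ge x y nq).
have [pn|np] := ltnP p n.
  rewrite catp_lt //; have [|le ge] := xy p (q - n) pn; first lia.
  by have <- : n - p + (q - n) = q - p by lia.
rewrite catp_ge //; have -> : q - p = q - n - (p - n) by lia.
by apply: qy; lia.
Qed.

Lemma geod_qgeod x n : (forall i j, i <= j <= n -> d (x i) (x j) = j - i) ->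
  qgeod 1 0 n x.
Proof. by move=> gx p q _ pq qn; rewrite gx ?pq //; lia. Qed.

(** A geodesic from [y k] to o is appended. Since [y k] is nearest to o, its point at distance q
    from [y k] is at distance at least q from every [y p]; so [d (y p) (y k)] is at most twice the
    distance across the corner, which gives the constant 2c + 1. *)
Lemma qgeod_to c k y o : qgeod c 0 k y -> (forall l, l <= k -> d (y k) o <= d (y l) o) ->
  exists z e, [/\ qgeod (2 * c).+1 0 (k + e) z, forall l, l <= k -> z l = y l &
    z (k + e) = o].
Proof.
move=> qy kmin; have [x [x0 xe gx]] := wdist_geodesic S (y k) o.
exists (catp y k x), (d (y k) o); split.
- apply: qgeod_cat.
  + by apply: qgeod_le qy; lia.
  + by apply: qgeod_le (geod_qgeod gx); lia.
  + move=> p q pk qe; have [|||le ge] := qy p k; [lia..|].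
    have g1 : d (y k) (x q) = q by rewrite -{1}x0 gx ?subn0.
    have g2 : d (x q) o = d (y k) o - q by rewrite -{1}xe gx // qe leqnn.
    have := kmin p (ltnW pk); have := wdist_triangle S (x q) (y p) o.
    have := wdist_triangle S (y k) (y p) (x q).
    have := wdist_triangle S (x q) (y p) (y k).
    rewrite (wdist_sym S (x q) (y k)) g1 g2 => t1 t2 t3 mn.
    have A : q <= d (y p) (x q) by lia.
    have B : d (y p) (y k) <= 2 * d (y p) (x q) by lia.
    split.
      by move: t2 le {t1 t3}; move: (k - p) (d (y p) (y k)) (d (y p) (x q)) => t D D'; nia.
    by move: A B ge {t1 t2 t3 mn le}; move: (k - p) (d (y p) (y k)) (d (y p) (x q)) => t D D'; nia.
- by move=> l lk; rewrite catp_le.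
- by rewrite catpD xe.
Qed.

Lemma qgeod_nearest c m y o : qgeod c 0 m y -> exists k, [/\ k <= m,
  forall l, l <= m -> d (y k) o <= d (y l) o,
  exists z e, [/\ qgeod (2 * c).+1 0 (k + e) z, forall l, l <= k -> z l = y l &
    z (k + e) = o] &
  exists z e, [/\ qgeod (2 * c).+1 0 (e + (m - k)) z, z 0 = o &
    forall l, k <= l <= m -> z (e + (l - k)) = y l]].
Proof.
move=> qy; have [k km kmin] : exists2 k, k <= m &
    forall l, l <= m -> d (y k) o <= d (y l) o.
  have := @arg_minnP _ (ord0 : 'I_m.+1) xpredT (fun i => d (y i) o) isT.
  case=> k _ kmin; exists k; first by rewrite -ltnS ltn_ord.
  by move=> l; rewrite -ltnS => lm; exact: (kmin (Ordinal lm)).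
exists k; split=> //.
  apply: qgeod_to; first by apply: qgeod_sub qy.
  by move=> l lk; apply: kmin; lia.
have [||z [e [qz zy ze]]] := @qgeod_to c (m - k) (fun t => y (m - t)) o.
- by apply: qgeod_sub (qgeod_rev qy) => //; lia.
- by move=> l lk; rewrite subKn //; apply: kmin; lia.
exists (fun t => z (m - k + e - t)), e; split.
- by rewrite addnC; exact: qgeod_rev.
- by rewrite subn0.
- move=> l lkm; have -> : m - k + e - (e + (l - k)) = m - l by lia.
  by rewrite zy; [congr y; lia|lia].
Qed.

(** The second summand serves the second half, whose initial point [x n] has to be moved to [y 0], a
    perturbation by at most e. *)
Definition junction_gauge e N c := N (2 * c).+1 + N (pert_const e (2 * c).+1).

(* A quasi-geodesic from one path to the other is cut at its point nearest to
   the junction; a geodesic from there to the junction completes each half to a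
   quasi-geodesic with both endpoints on the same path. *)
Lemma dmorse_junction e N x n y m p q c h s : dmorse N 0 n x -> dmorse N 0 m y ->
  d (x n) (y 0) <= e -> p <= n -> q <= m ->
  qgeod c 0 h s -> s 0 = x p -> s h = y q -> forall l, l <= h ->
  (exists2 k, p <= k <= n & d (s l) (x k) <= junction_gauge e N c) \/
  (exists2 k, k <= q & d (s l) (y k) <= junction_gauge e N c).
Proof.
move=> mx my xy pn qm qs s0 sh l lh; rewrite /junction_gauge.
have [k [kh _ [z [f [qz zs zo]]] [z' [f' [qz' zo' zs']]]]] := qgeod_nearest (x n) qs.
have [lk|kl] := leqP l k.
  left; have [|||||t tpn] := mx p n _ _ _ _ _ _ qz _ zo l; [lia..| | |].
  - by rewrite zs.
  - lia.
  by rewrite zs // => dt; exists t => //; lia.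
right; have zl := zs' l; have zh := zs' h.
(* The second half starts at [x n]; its first point is replaced by [y 0] to make it a competitor of
   y. The indices evaluated below are positive because k < l, so they see z' itself. *)
have [|||||||t tpq] := my 0 q _ _ _ (pert_const e (2 * c).+1) (f' + (h - k))
  (fun i => if i is 0 then y 0 else z' i) _ _ _ (f' + (l - k)); [lia..| | | | |].
- apply: qgeod_pert qz' => -[|i] _; first by rewrite zo'.
  by rewrite wdistxx.
- by [].
- have -> : f' + (h - k) = (f' + (h - k)).-1.+1 by lia.
  rewrite prednK; last lia.
  by rewrite zh // ; lia.
- lia.
have -> : f' + (l - k) = (f' + (l - k)).-1.+1 by lia.
rewrite prednK; last lia.
rewrite zl; last lia.
by move=> dt; exists t; lia.
Qed.

Definition cat_gauge e N c := junction_gauge e N c + N c + e.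

Lemma dmorse_cat e N x n y m : dmorse N 0 n x -> dmorse N 0 m y ->
  d (x n) (y 0) <= e -> dmorse (cat_gauge e N) 0 (n + m) (catp x n y).
Proof.
move=> mx my xy p q _ pq qnm c h s qs.
have [qn|nq] := ltnP q n.
  rewrite !catp_lt //; last lia.
  move=> s0 sh l lh; have [|||k kpq dk] := mx p q _ _ _ _ _ _ qs s0 sh l lh; [lia..|].
  by exists k => //; rewrite catp_lt /cat_gauge /junction_gauge; lia.
rewrite (catp_ge x y nq); have [pn|np] := ltnP p n; last first.
  rewrite catp_ge // => s0 sh l lh.
  have [|||k kpq dk] := my (p - n) (q - n) _ _ _ _ _ _ qs s0 sh l lh; [lia..|].
  by exists (n + k); [lia|rewrite catpD /cat_gauge; lia].
rewrite catp_lt // => s0 sh l lh.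
have [||[k kpn dk]|[k kq dk]] := dmorse_junction mx my xy _ _ qs s0 sh lh; [lia..| |].
  have [kn|nk] := ltnP k n; first by exists k; [lia|rewrite catp_lt /cat_gauge; lia].
  (* The point [x n] is not on the concatenation; [y 0], within e of it, takes its place. *)
  exists n; first lia.
  have kE : k = n by lia.
  rewrite -[X in catp _ _ _ X]addn0 catpD /cat_gauge.
  by move: dk; rewrite kE; have := wdist_triangle S (x n) (s l) (y 0); lia.
by exists (n + k); [lia|rewrite catpD /cat_gauge; lia].
Qed.

Definition append_const e c := c * e.+1 + e.+1.

(** The Morse condition asks for exact endpoints; a last jump of length at most e corrects an
    endpoint that is merely close. *)
Lemma qgeod_append e c n x v : qgeod c 0 n x -> d (x n) v <= e ->
  qgeod (append_const e c) 0 n.+1 (catp x n.+1 (fun=> v)).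
Proof.
move=> qx xv; rewrite -[X in qgeod _ _ X]addn0 /append_const.
have Q : qgeod (append_const e c) 0 n x by apply: qgeod_le qx; rewrite /append_const; nia.
move=> p q _ pq qn; rewrite /catp.
have [qn'|nq] := ltnP q n.+1.
  by rewrite (leq_ltn_trans pq qn'); apply: Q.
have qE : q = n.+1 by lia.
have [pn|np] := ltnP p n.+1; last first.
  by have -> : p = q by [lia]; rewrite wdistxx; split; lia.
have [|||le ge] := qx p n; [lia..|].
have := wdist_triangle S (x n) (x p) v; have := wdist_triangle S v (x p) (x n).
rewrite (wdist_sym S v (x n)) qE subSn // => t1 t2.
split.
  have : d (x p) v <= c * (n - p) + e by lia.
  by move: (n - p) (d (x p) v) => t D; nia.
have : d (x p) (x n) <= d (x p) v + e by lia.
by move: ge; move: (n - p) (d (x p) v) (d (x p) (x n)) => t D D'; nia.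
Qed.

End CoarsePaths.

(** * Stable subgroups *)

Lemma nat_argmin (T : Type) (P : T -> Prop) (f : T -> nat) : (exists t, P t) ->
  exists2 t, P t & forall s, P s -> f t <= f s.
Proof.
move=> [t0 Pt0]; have ex : exists n, `[< exists2 t, P t & f t = n >].
  by exists (f t0); apply/asboolP; exists t0.
have [n /asboolP[t Pt ft] nmin] := ex_minnP ex; exists t => // s Ps.
by rewrite ft; apply: nmin; apply/asboolP; exists s.
Qed.

Lemma finite_uniform (T : Type) (A : set T) (P : T -> nat -> Prop) :
  finite_set A -> (forall a, A a -> exists n, P a n) ->
  (forall a n m, n <= m -> P a n -> P a m) -> exists n, forall a, A a -> P a n.
Proof.
move=> Af AP Pmono.
have /choice[f fP] : forall a, exists n, A a -> P a n.
  by move=> a; have [/AP[n]|nA] := pselect (A a); [exists n|exists 0].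
have [M hM] : exists M, forall a, A a -> f a <= M.
  have /finite_seqP[s sE] := finite_image f Af.
  exists (\max_(n <- s) n) => a Aa; apply: (@leq_bigmax_seq _ s xpredT (fun n => n)) => //.
  by have : [set` s] (f a) by [rewrite -sE; exists a].
by exists M => a Aa; apply: Pmono (fP a Aa); exact: hM.
Qed.

Section StableSubgroup.
Context (G : groupType) (S : finGenSet G) (H : groupClosed G).
Implicit Types (x y z : nat -> G) (N : nat -> nat) (g h k p u v w : G).
Local Notation d := (wdist S).
Local Notation "`| g |" := (wlen S g) : nat_scope.

(** The error 2 comes from rounding the points of a real geodesic to vertices at distance at most
    1. *)
Definition stable_paths N r (alpha : G -> nat -> G) := forall h, h \in H ->
  [/\ alpha h 0 = 1%g, alpha h `|h| = h,
      forall i j, i <= j <= `|h| ->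
        d (alpha h i) (alpha h j) <= j - i + 2 /\
        j - i <= d (alpha h i) (alpha h j) + 2,
      dmorse S N 0 `|h| (alpha h) &
      forall i, i <= `|h| -> exists2 k, k \in H & d (alpha h i) k <= r].

Context (N : nat -> nat) (r : nat) (alpha : G -> nat -> G).
Hypothesis st : stable_paths N r alpha.

Lemma alpha_qgeod h : h \in H -> qgeod S 3 0 `|h| (alpha h).
Proof.
move=> /st[_ _ ah _ _] p q _ pq qn; have [|le ge] := ah p q; first by rewrite pq.
have [->|/eqP] := eqVneq p q; first by rewrite wdistxx; lia.
by lia.
Qed.

Lemma alpha_near g h i : h \in H -> i <= `|h| ->
  exists2 k, k \in H & d (g * alpha h i)%g (g * k)%g <= r.
Proof.
by move=> /st[_ _ _ _ +] ih => /(_ i ih)[k kH dk]; exists k; rewrite ?wdist_mull.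
Qed.

Lemma alpha_dist0 g h i : h \in H -> i <= `|h| -> i <= d g (g * alpha h i)%g + 2.
Proof.
move=> /st[a0 _ ah _ _] ih; have [|_] := ah 0 i; first by rewrite ih.
by rewrite a0 subn0 -(wdist_mull _ g) mulg1.
Qed.

Lemma alpha_distn g h i : h \in H -> i <= `|h| ->
  `|h| - i <= d (g * alpha h i)%g (g * h)%g + 2.
Proof.
move=> /st[_ an ah _ _] ih; have [|_] := ah i `|h|; first by rewrite ih leqnn.
by rewrite an wdist_mull.
Qed.

Lemma alpha_dist0_le g h i : h \in H -> i <= `|h| -> d g (g * alpha h i)%g <= i + 2.
Proof.
move=> /st[a0 _ ah _ _] ih; have [|+ _] := ah 0 i; first by rewrite ih.
by rewrite a0 subn0 -(wdist_mull _ g) mulg1.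
Qed.

Lemma alpha_distn_le g h i : h \in H -> i <= `|h| ->
  d (g * alpha h i)%g (g * h)%g <= `|h| - i + 2.
Proof.
move=> /st[_ an ah _ _] ih; have [|+ _] := ah i `|h|; first by rewrite ih leqnn.
by rewrite an wdist_mull.
Qed.

(** Equivalently, p is a nearest-point projection of the identity to the coset p H. *)
Definition short p := forall h, h \in H -> `|p| <= `|p * h|%g.

Let cS := 2 * r + 3.

(** The nearest-point argument of [qgeod_to]: the point [x i] is at distance at least [|p| - i] from
    p H, and the second path stays within r of p H, so distances across the corner cannot collapse.
    The constant does not depend on p. *)
Lemma short_cat_qgeod p a x : short p -> a \in H -> x 0 = 1%g -> x `|p| = p ->
  (forall i j, i <= j <= `|p| -> d (x i) (x j) = j - i) ->
  qgeod S cS 0 (`|p| + `|a|) (catp x `|p| (fun t => p * alpha a t)%g).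
Proof.
move=> sp aH x0 xp gx; apply: qgeod_cat.
- by apply: qgeod_le (geod_qgeod gx); rewrite /cS; lia.
- by apply: qgeod_mull; apply: qgeod_le (alpha_qgeod aH); rewrite /cS; lia.
move=> i j ip ja; have [k kH dk] := alpha_near p aH ja.
have jd := alpha_dist0 p aH ja; have dj := alpha_dist0_le p aH ja.
have xi1 : d 1%g (x i) = i by rewrite -x0 gx; lia.
have xip : d (x i) p = `|p| - i by rewrite -{1}xp gx; lia.
have := sp k kH; rewrite {2}/wlen => pk.
have := wdist_triangle S (x i) 1%g (p * k)%g.
have := wdist_triangle S (p * alpha a j)%g (x i) (p * k)%g.
have := wdist_triangle S (x i) p (p * alpha a j)%g.
have := wdist_triangle S p (x i) (p * alpha a j)%g.
rewrite (wdist_sym S p (x i)) => t1 t2 t3 t4.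
have : `|p| - i <= d (x i) (p * alpha a j)%g + r by lia.
rewrite /cS; split; nia.
Qed.

(* Let k in H and g^-1 k g in H with k long. Then [1,g], a path in g H and
   k [g,1] form a quasi-geodesic with constants independent of g, joining two
   points of H. *)
Lemma short_double_coset g :
  (forall a b, a \in H -> b \in H -> `|g| <= `|a * g * b|%g) ->
  (forall B, exists k, [/\ k \in H, (g^-1 * k * g)%g \in H & B <= `|k|]) ->
  `|g| <= N cS + r.
Proof.
(* Beyond 8e the two geodesic sides are far apart: their distance is at least |k| - 2e, and this is
   at least half of the parameter gap, which is at most |k| + 4e. *)
move=> gmin; set e := `|g| => /(_ (8 * e).+1)[k [kH hH kbig]].
set h := (g^-1 * k * g)%g in hH.
have gh : (g * h = k * g)%g by rewrite /h !mulgA mulgV mul1g.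
have sg : short g by move=> a aH; have := gmin 1%g a gpred1 aH; rewrite mul1g.
have [x [x0 xe gx]] := wdist_geodesic S 1%g g; rewrite -/(wlen S g) -/e in xe gx.
have [a0 an _ _ _] := st hH.
pose z1 := catp x e (fun t => g * alpha h t)%g.
pose z2 := fun j => (k * x (e - j))%g.
have z1j : z1 (e + `|h|) = z2 0 by rewrite /z1 catpD /z2 subn0 xe an gh.
have hlen : `|h| = d g (k * g)%g by rewrite -gh wdistE mulKg.
have hk : `|h| <= `|k| + 2 * e.
  rewrite hlen; have := wdist_triangle S 1%g g (k * g)%g.
  have := wdist_triangle S k 1%g (k * g)%g.
  by rewrite wdist_mulr (wdist_sym S g 1%g) -/(wlen S g) -/e -/(wlen S k); lia.
have kh : `|k| <= `|h| + 2 * e.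
  rewrite hlen.
  have := wdist_triangle S (k * g)%g g k.
  have := wdist_triangle S g 1%g k.
  by rewrite wdist_mull1 -/(wlen S g) -/e -/(wlen S k); lia.
have Q : qgeod S cS 0 (e + `|h| + e) (catp z1 (e + `|h|) z2).
  apply: qgeod_cat.
  - exact: short_cat_qgeod.
  - apply: qgeod_mull; apply: qgeod_le (qgeod_rev (geod_qgeod gx)).
    by rewrite /cS; lia.
  move=> p q pe qe.
  have z2k : d (z2 q) k = e - q.
    by rewrite /z2 -{2}(mulg1 k) wdist_mull wdist_sym -x0 gx; lia.
  have z2kg : d (k * g)%g (z2 q) = q.
    by rewrite /z2 wdist_mull wdist_sym -{1}xe gx; lia.
  have [pe'|ep] := ltnP p e.
    rewrite /z1 catp_lt //.
    have xp1 : d 1%g (x p) = p by rewrite -x0 gx; lia.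
    have xpg : d (x p) g = e - p by rewrite -{1}xe gx; lia.
    have := wdist_triangle S (x p) 1%g k; have := wdist_triangle S (z2 q) (x p) k.
    have := wdist_triangle S g (x p) (z2 q).
    have := wdist_triangle S (k * g)%g g (z2 q); rewrite -hlen -/(wlen S k) /cS.
    by move=> t1 t2 t3 t4; split; nia.
  rewrite /z1 catp_ge //; set t := p - e; have th : t <= `|h| by lia.
  have [b bH db] := alpha_near g hH th.
  have tn := alpha_distn g hH th; have nt := alpha_distn_le g hH th.
  (* Minimality in the double coset keeps k at distance at least e from g H, hence [z2 q], at
     distance e - q from k, at distance at least q from g H. *)
  have kgb : e <= d k (g * b)%g.
    have := gmin k^-1%g b; rewrite gpredV kH bH => /(_ isT isT).
    by rewrite wdistE mulgA.
  have := wdist_triangle S (g * alpha h t)%g k (g * b)%g.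
  have := wdist_triangle S (z2 q) k (g * alpha h t)%g.
  have := wdist_triangle S (z2 q) (g * alpha h t)%g (k * g)%g.
  have := wdist_triangle S (k * g)%g (g * alpha h t)%g (z2 q).
  rewrite !(wdist_sym S (z2 q)) in z2k z2kg *; rewrite -gh in z2kg *.
  rewrite /cS => t1 t2 t3 t4.
  have -> : e + `|h| - p = `|h| - t by lia.
  have : q <= d (g * alpha h t)%g (z2 q) + r by lia.
  by split; nia.
have [b0 bn _ mb _] := st kH.
have [||||||s sk] := mb 0 `|k| _ _ _ _ _ _ Q _ _ e; [lia..| | | |].
- rewrite b0 catp_lt; last lia.
  by rewrite /z1 catp_le ?x0 // a0 mulg1 xe.
- by rewrite bn catpD /z2 subnn x0 mulg1.
- lia.
rewrite catp_le // /z1; last lia.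
rewrite catp_ge // subnn a0 mulg1 => ds.
have [q qH dq] := alpha_near 1%g kH (proj2 (andP sk)); rewrite !mul1g in dq.
(* By minimality again, g is at distance at least [|g|] from all of H, whereas the Morse property
   has just placed it near q. *)
have := gmin q^-1%g 1%g; rewrite gpredV gpred1 => /(_ qH isT).
rewrite mulg1 -wdistE wdist_sym => gq.
by have := wdist_triangle S (alpha k s) g q; rewrite /e; lia.
Qed.

End StableSubgroup.

(** * Coarse Helly property of cosets *)

Section CoarseHelly.
Context (G : groupType) (S : finGenSet G) (H : groupClosed G).
Context (N : nat -> nat) (r : nat) (alpha : G -> nat -> G).
Hypothesis st : stable_paths S H N r alpha.
Implicit Types (x y z : nat -> G) (g h k p u v w : G).
Local Notation d := (wdist S).
Local Notation "`| g |" := (wlen S g) : nat_scope.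

Context (D : nat).
Hypothesis cosets_close :
  forall g, exists a b, [/\ a \in H, b \in H & `|a * g * b|%g <= D].

(** The coset p H comes within D of H, at [p * b] and [a^-1]. The geodesic [1, p], a path in p H to
    [p * b] and a jump to [a^-1] form a quasi-geodesic between points of H; the Morse property then
    puts p near H. *)
Lemma short_near : exists K, forall p, short S H p ->
  exists2 h, h \in H & d h p <= K.
Proof.
exists (N (append_const D (2 * r + 3)) + r) => p sp.
have [a [b [aH bH abD]]] := cosets_close p.
have [x [x0 xp gx]] := wdist_geodesic S 1%g p.
have := short_cat_qgeod st sp bH x0 xp gx; set P := catp _ _ _; set n := (`|p| + _) => Q.
have [b0 bn _ _ _] := st bH.
have Pn : P n = (p * b)%g by rewrite /P /n catpD bn.
have Pp : P `|p| = p by rewrite /P catp_ge // subnn b0 mulg1.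
have P0 : P 0 = 1%g by rewrite /P catp_le // xp b0 mulg1.
have aV : a^-1%g \in H by rewrite gpredV.
have Q' : qgeod S (append_const D (2 * r + 3)) 0 n.+1 (catp P n.+1 (fun=> a^-1%g)).
  by apply: qgeod_append Q _; rewrite Pn wdist_sym wdistE invgK mulgA.
have [a0 an _ ma _] := st aV.
have [|||s sk] := ma 0 _ (leqnn _) (leq0n _) (leqnn _) _ _ _ Q' _ _ `|p|.
- by rewrite catp_lt // P0 a0.
- by rewrite catp_ge // an.
- by rewrite /n; lia.
rewrite catp_lt ?Pp; last by rewrite /n; lia.
move=> dp; have [k kH dk] := alpha_near st 1%g aV (proj2 (andP sk)).
rewrite !mul1g in dk; exists k => //; rewrite wdist_sym.
by have := wdist_triangle S (alpha a^-1%g s) p k; lia.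
Qed.

(* The quasi-geodesic [1,p] followed by a path in p H ends near q H, so it stays
   near a Morse path from 1 to q followed by a path in q H. *)
Lemma short_pair : exists K, forall p q, short S H p -> short S H q ->
  `|q| <= `|p| -> exists b c, [/\ `|b| <= K, c \in H & (p * b = q * c)%g].
Proof.
have [K0 near] := short_near.
set c3 := append_const D (2 * r + 3); set K1 := junction_gauge K0 N c3.
exists (2 * K0 + 2 * K1 + 4 + r) => p q sp sq qp.
have [a [b [aH bH]]] := cosets_close (p^-1 * q)%g; rewrite !mulgA => abD.
have aV : a^-1%g \in H by rewrite gpredV.
have [h hH hq] := near q sq.
have [x [x0 xp gx]] := wdist_geodesic S 1%g p.
have := short_cat_qgeod st sp aV x0 xp gx; set P := catp _ _ _; set n := (`|p| + _) => Q.
have [a0 an _ _ _] := st aV; have [b0 bn _ mb _] := st bH.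
have [h0 hn _ mh _] := st hH.
have Pn : P n = (p * a^-1)%g by rewrite /P /n catpD an.
have Pp : P `|p| = p by rewrite /P catp_ge // subnn a0 mulg1.
have P0 : P 0 = 1%g by rewrite /P catp_le // xp a0 mulg1.
have Q' : qgeod S c3 0 n.+1 (catp P n.+1 (fun=> (q * b)%g)).
  by apply: qgeod_append Q _; rewrite Pn wdistE invgM invgK !mulgA.
have hq' : d (alpha h `|h|) ((q * alpha b 0)%g) <= K0 by rewrite hn b0 mulg1.
have mb' := dmorse_mull (g := q) mb.
have pn : `|p| <= n.+1 by rewrite /n; lia.
have [|||] := dmorse_junction mh mb' hq' (leq0n _) (leqnn _) Q' _ _ pn.
- by rewrite catp_lt // P0 h0.
- by rewrite catp_ge // bn.
- rewrite catp_lt ?Pp; last by rewrite /n; lia.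
  (* Here p is close to a point of the path from 1 to h. As [|q| <= |p|], that point is close to the
     end h, hence to q, and p is close to q itself. *)
  move=> [k /andP[_ kh] dk]; exists (p^-1 * q)%g, 1%g.
  rewrite gpred1 mulg1 mulVKg -wdistE; split=> //.
  have := alpha_dist0_le st 1%g hH kh; have := alpha_distn_le st 1%g hH kh.
  rewrite !mul1g => t1 t2.
  have := wdist_triangle S (alpha h k) p q; have := wdist_triangle S h (alpha h k) q.
  have := wdist_triangle S (alpha h k) 1%g p; have := wdist_triangle S q 1%g h.
  rewrite (wdist_sym S (alpha h k) p) (wdist_sym S q h) -/(wlen S p) -/(wlen S q) -/(wlen S h).
  rewrite -/K1 in dk; lia.
rewrite catp_lt ?Pp; last by rewrite /n; lia.
move=> [k kb dk]; have [t tH dt] := alpha_near st q bH kb.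
exists (p^-1 * (q * t))%g, t; rewrite mulVKg -wdistE; split=> //.
have := wdist_triangle S (q * alpha b k)%g p (q * t)%g; rewrite -/K1 in dk; lia.
Qed.

(** Pigeonhole: among more cosets than the ball of radius K has elements, let p be the longest short
    representative. By [short_pair] every one of them is the coset of some [p * b] with b in that
    ball. *)
Lemma finite_index : ~ infinite_index H.
Proof.
have [K pair] := short_pair => inf.
pose coset p : set G := [set (p * h)%g | h in [set` H]].
have coset_eq p q c : c \in H -> (p = q * c)%g -> coset p = coset q.
  move=> cH ->; apply/seteqP; split=> _ [h hH <-].
    by exists (c * h)%g; rewrite ?mulgA //; apply: gpredM.
  by exists (c^-1 * h)%g; [apply: gpredM => //; rewrite gpredV|rewrite mulgA mulgK].
have short_rep g : exists2 p, short S H p & coset p = coset g.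
  have [|p pg pmin] := @nat_argmin G (fun p => exists2 h, h \in H & p = (g * h)%g) (wlen S).
    by exists g; exists 1%g; rewrite ?gpred1 ?mulg1.
  case: pg pmin => h hH -> pmin; exists (g * h)%g; last exact: coset_eq hH _.
  by move=> k kH; apply: pmin; exists (h * k)%g; rewrite ?mulgA //; apply: gpredM.
have [B BE] := finite_fsetP.1 (finite_ball S K).
have [F FA FB] := infinite_set_fset #|` B|.+1 inf.
have /choice[rep repP] : forall C, exists p, C \in F -> short S H p /\ coset p = C.
  move=> C; have [CF|] := boolP (C \in F); last by exists 1%g.
  have [g _ <-] := FA _ CF; have [p sp pg] := short_rep g; by exists p.
have [C0 C0F] : exists C, C \in F.
  by apply/fset0Pn; rewrite -cardfs_gt0; lia.
have [M MF Mmax] : exists2 M, M \in F & forall C, C \in F -> `|rep C| <= `|rep M|.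
  (* A longest representative is found by minimising its deficit from the maximum. *)
  have [|M MF Mmin] := @nat_argmin _ (fun C => C \in F)
      (fun C => \max_(C <- F) `|rep C| - `|rep C|); first by exists C0.
  exists M => // C CF; have := Mmin C CF.
  have m1 : `|rep C| <= \max_(C <- F) `|rep C| by apply: (@leq_bigmax_seq _ (enum_fset F) xpredT (fun C => `|rep C|)).
  have m2 : `|rep M| <= \max_(C <- F) `|rep C| by apply: (@leq_bigmax_seq _ (enum_fset F) xpredT (fun C => `|rep C|)).
  lia.
have sub : (F `<=` [fset coset (rep M * b)%g | b in B])%fset.
  apply/fsubsetP => C CF; have [sC CE] := repP C CF; have [sM _] := repP M MF.
  have [b [c [bK cH bc]]] := pair _ _ sM sC (Mmax C CF).
  apply/imfsetP; exists b.
    by have : [set` B] b by [rewrite -BE].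
  by rewrite -CE; apply/esym; apply: coset_eq cH bc.
by have := leq_trans (fsubset_leq_card sub) (leq_imfset_card _ _ _); rewrite leqNgt FB.
Qed.

End CoarseHelly.

(** * Transversality of H and g H *)

Section Transversality.
Context (G : groupType) (S : finGenSet G) (H : groupClosed G).
Context (N : nat -> nat) (r : nat) (alpha : G -> nat -> G).
Hypothesis st : stable_paths S H N r alpha.
Implicit Types (x y z : nat -> G) (g h k p u v : G) (w : seq G).
Local Notation d := (wdist S).
Local Notation "`| g |" := (wlen S g) : nat_scope.

(** Otherwise [short_double_coset] applies to a shortest element of each double coset and bounds its
    length uniformly, so that [finite_index] contradicts the infinite index. *)
Lemma exists_transverse : infinite_index H ->
  exists g B, forall k, k \in H -> (g^-1 * k * g)%g \in H -> `|k| <= B.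
Proof.
move=> inf; apply: contrapT => no.
have long g B : exists k, [/\ k \in H, (g^-1 * k * g)%g \in H & B <= `|k|].
  apply: contrapT => nk; apply: no; exists g, B => k kH gkH.
  by rewrite leqNgt; apply/negP => Bk; apply: nk; exists k; split=> //; exact: ltnW.
apply: (finite_index st (D := N (2 * r + 3) + r)) inf => g.
pose P (ab : G * G) := ab.1 \in H /\ ab.2 \in H.
have [|[a b] [/= aH bH] abmin] := @nat_argmin _ P (fun ab => `|ab.1 * g * ab.2|%g).
  by exists (1%g, 1%g); rewrite /P gpred1.
exists a, b; split=> //; apply: (short_double_coset st) (long _) => a' b' a'H b'H.
rewrite !mulgA -(mulgA _ b b'); apply: (abmin (a' * a, b * b')%g).
by split; apply: gpredM.
Qed.

Context (g : G) (B : nat).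
Hypothesis transverse : forall k, k \in H -> (g^-1 * k * g)%g \in H -> `|k| <= B.

(** Two solutions of [h^-1 * g * h' = b] differ by [h * h1^-1], which lies in H and in its conjugate
    by g, so its length is at most B. Hence each b bounds |h|, and there are finitely many b in the
    ball of radius K. *)
Lemma transverse_bound K : exists C, forall h h', h \in H -> h' \in H ->
  d h (g * h')%g <= K -> `|h| <= C.
Proof.
pose P b C := forall h h', h \in H -> h' \in H -> (h^-1 * g * h')%g = b -> `|h| <= C.
have [||C CP] := finite_uniform (P := P) (finite_ball S K).
- move=> b _; have [[h1 [h1' [h1H h1H' e1]]]|no] :=
    pselect (exists h1 h1', [/\ h1 \in H, h1' \in H & (h1^-1 * g * h1')%g = b]).
    exists (B + `|h1|) => h h' hH hH' e.
    have := transverse (k := (h * h1^-1)%g); have -> : (g^-1 * (h * h1^-1) * g = h' * h1'^-1)%g.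
      have -> : (h = g * h' * b^-1)%g by rewrite -e !invgM !invgK !mulgA mulgK mulgV mul1g.
      have -> : (h1 = g * h1' * b^-1)%g by rewrite -e1 !invgM !invgK !mulgA mulgK mulgV mul1g.
      by rewrite !invgM !invgK !mulgA mulVg mul1g !mulgVK.
    have V1 : h1^-1%g \in H by rewrite gpredV.
    have V1' : h1'^-1%g \in H by rewrite gpredV.
    move=> /(_ (gpredM _ _ hH V1) (gpredM _ _ hH' V1')) le.
    by have := wlenM S (h * h1^-1)%g h1; rewrite mulgVK; lia.
  by exists 0 => h h' hH hH' e; case: no; exists h, h'.
- by move=> b n m nm Pn h h' hH hH' e; apply: leq_trans nm; exact: Pn e.
exists C => h h' hH hH'; rewrite wdistE mulgA => le; exact: (CP _ le _ _ hH hH').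
Qed.

(** Translation by [h0^-1] reduces this to [transverse_bound]. It locates near h0 the place where a
    word path can pass from H to the coset of [h0 * g]. *)
Lemma transverse_near K : exists C, forall h0 h h' u, h0 \in H -> h \in H -> h' \in H ->
  d u h <= K -> d u (h0 * g * h')%g <= K -> d h0 u <= C.
Proof.
have [C CP] := transverse_bound (2 * K); exists (C + K) => h0 h h' u h0H hH hH' uh uh'.
have V0 : h0^-1%g \in H by rewrite gpredV.
have := CP (h0^-1 * h)%g h' (gpredM _ _ V0 hH) hH'.
rewrite -wdistE -(wdist_mull S h0) !mulgA mulgV mul1g => le.
have := wdist_triangle S u h (h0 * g * h')%g; rewrite (wdist_sym S h u) => t1.
have {}/le h0h : d h (h0 * g * h')%g <= 2 * K by lia.
by have := wdist_triangle S h h0 u; rewrite (wdist_sym S h u); lia.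
Qed.

(** Here 7 = 2 * 3 + 1 is the constant that [qgeod_nearest] gives for blocks of constant 3. *)
Let c9 := append_const `|g| 7.

(** Let u be on the first block, v on the second, and w nearest to u on the part of the second block
    from [h1 * g] to v. A geodesic from u to w, continued to [h1 * g] and then to h1, is a
    quasi-geodesic with endpoints on the first block, so w is close to H and to the coset of
    [h1 * g], hence to h1. Since w is no farther from u than v is, d(u, h1) and d(h1, v) are bounded
    linearly in d(u, v). *)
Lemma two_blocks_qgeod : exists c, forall h1 h2, h1 \in H -> h2 \in H ->
  qgeod S c 0 (`|h1| + `|h2|) (catp (alpha h1) `|h1| (fun t => h1 * g * alpha h2 t)%g).
Proof.
have [C near] := transverse_near (N c9 + r).
exists (6 * C + 3 * `|g| + 9) => h1 h2 h1H h2H.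
have q1 := alpha_qgeod st h1H; have q2 := qgeod_mull (h1 * g)%g (alpha_qgeod st h2H).
have [a0 an _ ma _] := st h1H; have [b0 _ _ _ _] := st h2H.
apply: qgeod_cat; [by apply: qgeod_le q1; lia|by apply: qgeod_le q2; lia|].
move=> p q pn qn; set u := alpha h1 p; set v := (_ * alpha h2 q)%g.
have qs : qgeod S 3 0 q (fun t => h1 * g * alpha h2 (q - t))%g.
  by apply: (qgeod_rev (x := fun t => h1 * g * alpha h2 t)%g); apply: qgeod_sub q2.
have [k [kq kmin _ [z [e [qz z0 ze]]]]] := qgeod_nearest u qs.
have h1g : d (z (e + (q - k))) h1 <= `|g|.
  by rewrite ze ?leqnn ?kq // subnn b0 mulg1 wdist_mull1.
have q' := qgeod_append qz h1g.
have [|||||t tpn] := ma p `|h1| _ _ (leqnn _) _ _ _ q' _ _ e; [lia..| | | |].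
- by rewrite catp_lt // z0.
- by rewrite catp_ge // an.
- lia.
rewrite catp_lt; last lia.
have := ze k; rewrite subnn addn0 leqnn kq => /(_ isT) ->.
set w := (_ * alpha h2 (q - k))%g => dt.
have [|x xH dx] := alpha_near st 1%g h1H (i := t); first by case/andP: tpn.
rewrite !mul1g in dx.
have {}dt : d w (alpha h1 t) <= N c9 := dt.
have [|y yH dy] := alpha_near st (h1 * g)%g h2H (i := q - k); first lia.
have dw : d h1 w <= C.
  apply: (near h1 x y) => //; last by rewrite -/w in dy; lia.
  by have := wdist_triangle S (alpha h1 t) w x; lia.
have [|_ l1] := q1 p `|h1| isT _ (leqnn _); first lia.
have [|_ l2] := q2 (q - k) q isT _ qn; first lia.
have [|_ l3] := q2 0 (q - k) isT isT; first lia.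
have [|u1 _] := q1 p `|h1| isT _ (leqnn _); first lia.
have [|u2 _] := q2 0 q isT isT; first lia.
have := kmin 0 isT; rewrite subn0 => dmin.
rewrite b0 mulg1 in l3 u2; rewrite an -/u in l1 u1.
rewrite -/v -/w in l2 l3 u2 dmin.
have := wdist_triangle S u w v; have := wdist_triangle S w u h1.
have := wdist_triangle S h1 (h1 * g)%g w.
have := wdist_triangle S h1 u v; have := wdist_triangle S (h1 * g)%g h1 v.
rewrite wdist_mull1 wdist_mulr (wdist_sym S w u) (wdist_sym S v u) (wdist_sym S w h1) in dmin *.
move=> t1 t2 t3 t4 t5.
split; nia.
Qed.

End Transversality.

(** * Words *)

(** Discrete form of [MLTG], for paths without any continuity condition. *)
Definition local_to_global (G : groupType) (S : finGenSet G) :=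
  forall (c : nat) (N : nat -> nat), exists (L c' : nat) (N' : nat -> nat),
  forall n x, (forall i j, i <= j <= n -> j - i <= L ->
      qgeod S c i j x /\ dmorse S N i j x) ->
    qgeod S c' 0 n x /\ dmorse S N' 0 n x.

Section Words.
Context (G : groupType) (S : finGenSet G) (H : groupClosed G).
Context (N : nat -> nat) (r : nat) (alpha : G -> nat -> G).
Hypothesis st : stable_paths S H N r alpha.
Implicit Types (x y z : nat -> G) (h k p u v : G) (w : seq G).
Local Notation d := (wdist S).
Local Notation "`| g |" := (wlen S g) : nat_scope.
Context (g : G) (B : nat).
Hypothesis transverse : forall k, k \in H -> (g^-1 * k * g)%g \in H -> `|k| <= B.

Fixpoint word_val w : G := if w is h :: w' then (h * g * word_val w')%g else 1%g.

Fixpoint word_path w : nat -> G :=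
  if w is h :: w' then catp (alpha h) `|h| (fun t => h * g * word_path w' t)%g
  else fun=> 1%g.

Fixpoint word_size w := if w is h :: w' then `|h| + word_size w' else 0.

Definition long_letters L w := forall h, h \in w -> h \in H /\ L <= `|h|.

Lemma long_letters_cons L h w :
  long_letters L (h :: w) -> [/\ h \in H, L <= `|h| & long_letters L w].
Proof.
move=> lw; have [|hH hL] := lw h; first by rewrite mem_head.
by split=> // k kw; apply: lw; rewrite inE kw orbT.
Qed.

(** With an empty first block [catp] would start on the next one, hence the length bound 1. *)
Lemma word_path0 w : long_letters 1 w -> word_path w 0 = 1%g.
Proof.
case: w => [//|h w] /long_letters_cons[hH h1 _] /=.
by rewrite catp_lt //; have [] := st hH.
Qed.

Lemma word_path_size w : word_path w (word_size w) = word_val w.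
Proof. by elim: w => [//|h w IH] /=; rewrite catpD IH. Qed.

(** A window of length L meets at most two consecutive blocks, since each is longer than L;
    [two_blocks_qgeod] and [dmorse_cat] treat those. The constants are chosen before L, as the
    local-to-global property requires. *)
Lemma word_path_local : exists c N', forall L w, long_letters L.+1 w ->
  forall i j, i <= j <= word_size w -> j - i <= L ->
    qgeod S c i j (word_path w) /\ dmorse S N' i j (word_path w).
Proof.
have [c qc] := two_blocks_qgeod st transverse.
exists c, (cat_gauge `|g| N) => L; elim=> [|h w IH] lw i j /andP[ij jn] ijL.
  have [-> ->] : i = 0 /\ j = 0 by move: jn => /=; lia.
  split=> [p q _ pq q0|].
    by have [-> ->] : p = 0 /\ q = 0 by [lia]; rewrite wdistxx; split; lia.
  have [a0 _ _ ma _] := st (gpred1 (s := H)).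
  apply: (dmorse_le (N := N)); first by move=> e; rewrite /cat_gauge; lia.
  by apply: dmorse_ext (dmorse_sub _ _ ma) => // -[].
have [hH hL lw'] := long_letters_cons lw.
have [hi|ih] := leqP `|h| i.
  have [||q m] := IH lw' (i - `|h|) (j - `|h|).
  - by move: jn => /=; lia.
  - lia.
  have e t : i - `|h| <= t <= j - `|h| ->
      (h * g * word_path w t)%g = word_path (h :: w) (`|h| + t).
    by rewrite /= catpD.
  have := qgeod_mull (h * g)%g q; have := dmorse_mull (g := (h * g)%g) m.
  move=> /(dmorse_ext e)/dmorse_shift + /(qgeod_ext e)/qgeod_shift.
  by rewrite !subnKC //; lia.
have [k [kH jk e]] : exists k, [/\ k \in H, j <= `|h| + `|k| & forall t, i <= t <= j ->
    catp (alpha h) `|h| (fun t => h * g * alpha k t)%g t = word_path (h :: w) t].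
  case: w {IH lw} lw' jn => [|k w] lw jn.
    (* After the last letter only the index [|h|] remains, with value [h * g]; any second block
       starts there, and h itself is taken. *)
    exists h; split=> // [|t /andP[_ tj]]; rewrite /= in jn *; first lia.
    rewrite /catp; case: ltnP => // ht; have -> : t - `|h| = 0 by lia.
    by have [-> _ _ _ _] := st hH.
  have [kH kL _] := long_letters_cons lw; exists k; split=> // [|t /andP[_ tj]]; first lia.
  by rewrite /= /catp; case: ltnP => // ht; case: ltnP => // kt; lia.
have [_ an _ ma _] := st hH; have [a0 _ _ mk _] := st kH.
split; first by apply: qgeod_ext e _; apply: qgeod_sub (qc h k hH kH).
apply: dmorse_ext e _; apply: dmorse_sub (dmorse_cat ma (dmorse_mull (g := (h * g)%g) mk) _) => //.
by rewrite an a0 mulg1 wdist_mulr.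
Qed.

(* Two word paths with the same endpoints fellow-travel. Past h the first one
   leaves H, while up to h' the second one follows H, so h is not much shorter
   than h' and the two are close. *)
Lemma first_letter_close_le : local_to_global S ->
  exists L C, forall h w h' w', long_letters L (h :: w) -> long_letters L (h' :: w') ->
    word_val (h :: w) = word_val (h' :: w') -> `|h| <= `|h'| -> d h h' <= C.
Proof.
move=> ltg; have [c0 [N0 loc]] := word_path_local.
have [L [c1 [N1 glob]]] := ltg c0 N0.
pose K1 := N1 c1; pose c4 := append_const K1 c1; pose K4 := N1 c4.
have [C near] := transverse_near transverse (K4 + r).
pose C3 := c1 * (`|g| + C).+1.
(* Letters longer than L serve the local-to-global property. The extra length makes the second block
   longer than C3, a bound on the time that the path can stay near H after its first block. *)
exists (L.+1 + C3.+2), (C + `|g| + 2 * K1 + 10) => h w h' w' lw lw' ev hh'.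
pose X := word_path (h :: w); pose X' := word_path (h' :: w').
pose T := word_size (h :: w); pose T' := word_size (h' :: w').
have longS L' w0 : L' <= L.+1 + C3.+2 ->
    long_letters (L.+1 + C3.+2) w0 -> long_letters L' w0.
  by move=> LL lw0 k /lw0[kH kL]; split=> //; lia.
have [qX mX] : qgeod S c1 0 T X /\ dmorse S N1 0 T X.
  by apply: glob; apply: loc; apply: longS lw; lia.
have [qX' mX'] : qgeod S c1 0 T' X' /\ dmorse S N1 0 T' X'.
  by apply: glob; apply: loc; apply: longS lw'; lia.
have X0 : X 0 = 1%g by apply: word_path0; apply: longS lw; lia.
have X'0 : X' 0 = 1%g by apply: word_path0; apply: longS lw'; lia.
have XT : X T = X' T' by rewrite /X /T /X' /T' !word_path_size.
have [hH hL lw1] := long_letters_cons lw; have [h'H h'L lw1'] := long_letters_cons lw'.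
have X'h t : t < `|h'| -> X' t = alpha h' t by move=> th; rewrite /X' /= catp_lt.
have T'h : `|h'| <= T' by rewrite /T' /= leq_addr.
(* The last index on the block of h': at [|h'|] the path has already jumped to [h' * g]. *)
pose i := `|h'|.-1; have ih' : i < `|h'| by rewrite /i; lia.
have [|||||s /andP[_ sT] ds] := mX 0 T _ _ (leqnn _) _ _ _ qX' _ _ i; [lia..| | | |].
- by rewrite X0.
- by rewrite XT.
- lia.
(* The first path up to s, followed by a jump to [X' i], is a competitor of the first block of the
   second path, which stays near H. *)
have nearH t : t <= s -> exists2 k, k \in H & d (X t) k <= K4 + r.
  move=> ts; have qs : qgeod S c1 0 s X by apply: qgeod_sub qX.
  have q' : qgeod S c4 0 s.+1 (catp X s.+1 (fun=> X' i)).
    by apply: qgeod_append qs _; rewrite wdist_sym.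
  have [||||||k /andP[_ ki] dk] := mX' 0 i _ _ _ _ _ _ q' _ _ t; [lia..| | | |].
  - by rewrite catp_lt // X0 X'0.
  - by rewrite catp_ge.
  - lia.
  rewrite catp_lt in dk; last lia.
  rewrite X'h in dk; last lia.
  have [|a aH da] := alpha_near st 1%g h'H (i := k); first lia.
  rewrite !mul1g in da; exists a => //.
  by have := wdist_triangle S (alpha h' k) (X t) a; rewrite /K4; lia.
have Xg : X `|h| = (h * g)%g.
  rewrite /X /= catp_ge // subnn word_path0 ?mulg1 //; apply: longS lw1; lia.
have hs : d h (X s) <= C + `|g| + K1 + 7.
  (* If s is still on the block of h, comparing distances to 1 and using [|h| <= |h'|] shows that s
     is almost [|h|]. *)
  have [sh|hs] := ltnP s `|h|.
    have XE : X s = alpha h s by rewrite /X /= catp_lt.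
    have s1 := alpha_dist0_le st 1%g hH (ltnW sh).
    have s2 := alpha_distn_le st 1%g hH (ltnW sh).
    have s3 := alpha_dist0 st 1%g h'H (ltnW ih').
    rewrite !mul1g -XE -X'h // in s1 s2 s3.
    have := wdist_triangle S (X s) 1%g (X' i).
    rewrite (wdist_sym S (X s) (X' i)) (wdist_sym S h (X s)).
    by rewrite -/K1 in ds; rewrite /i in s3 ds *; lia.
  have [->|/eqP sh] := eqVneq s `|h|; first by rewrite Xg wdist_mulr; lia.
  case: w lw ev @X @T lw1 qX mX X0 XT sT Xg nearH ds => [|h2 w] lw ev X T lw1 qX mX X0 XT sT Xg nearH ds.
    by move: sT; rewrite /T /=; lia.
  have [h2H h2L lw2] := long_letters_cons lw1.
  (* The time s is truncated to the second block. There the point is near both H and the coset of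
     [h * g], hence near h, so t exceeds [|h|] by at most C3. The second letter is longer than that,
     so nothing was truncated and s = t. *)
  pose t := minn s (`|h| + `|h2|.-1).
  have Xt : X t = (h * g * alpha h2 (t - `|h|))%g.
    rewrite /X /= catp_ge; last by rewrite /t; lia.
    by rewrite catp_lt // /t; lia.
  have [|a aH da] := nearH t; first by rewrite /t; lia.
  have [|b bH db] := alpha_near st (h * g)%g h2H (i := t - `|h|); first by rewrite /t; lia.
  have dht : d h (X t) <= C.
    by apply: (near h a b) => //; rewrite Xt; apply: leq_trans db _; rewrite leq_addl.
  have [|||_ tc] := qX `|h| t; [by rewrite /t; lia..|].
  have := wdist_triangle S h (h * g)%g (X t); rewrite wdist_mull1 => t1.
  have tC : t - `|h| <= C3.
    apply: leq_trans tc _; rewrite /C3 leq_mul2l; apply/orP; right.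
    by rewrite Xg; lia.
  have -> : s = t by rewrite /t in tC *; lia.
  lia.
have := alpha_distn_le st 1%g h'H (ltnW ih').
have := wdist_triangle S (X s) (X' i) h; have := wdist_triangle S (X' i) h h'.
rewrite !mul1g -X'h // (wdist_sym S h (X' i)) (wdist_sym S h (X s)) in hs *.
by rewrite -/K1 in ds; rewrite /i in ds *; lia.
Qed.

Lemma first_letter_close : local_to_global S ->
  exists L C, forall h w h' w', long_letters L (h :: w) -> long_letters L (h' :: w') ->
    word_val (h :: w) = word_val (h' :: w') -> d h h' <= C.
Proof.
move=> /first_letter_close_le[L [C close]]; exists L, C => h w h' w' lw lw' ev.
have [hh'|/ltnW h'h] := leqP `|h| `|h'|; first exact: close ev hh'.
by rewrite wdist_sym; apply: close (esym ev) h'h.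
Qed.

End Words.

(** * Continuous paths in the Cayley graph *)

Local Open Scope ring_scope.

Section CayleyDistance.
Context (R : realType) (G : groupType) (S : finGenSet G).
Implicit Types (u v g : G) (f : G -> R).
Local Notation X := (cayley R S).

(** Both sides are the sum of the barycentric coordinates weighted by f; thus the affine extension
    of f depends on the point only, not on the edge used to describe it. *)
Lemma edge_point_affine f u v t u' v' t' :
  edge_point u v t = edge_point u' v' t' :> (G -> R) ->
  (1 - t) * f u + t * f v = (1 - t') * f u' + t' * f v'.
Proof.
move=> e; pose s := undup [:: u; v; u'; v'].
have sum u0 v0 (t0 : R) : u0 \in s -> v0 \in s ->
    \sum_(g <- s) edge_point u0 v0 t0 g * f g = (1 - t0) * f u0 + t0 * f v0.
  move=> us vs; under eq_bigr do rewrite /edge_point mulrDl.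
  rewrite big_split /=; congr (_ + _).
    rewrite (bigD1_seq u0) ?undup_uniq //= eqxx mulr1n big1 ?addr0 // => g gu.
    by rewrite (negbTE gu) mulr0n mul0r.
  rewrite (bigD1_seq v0) ?undup_uniq //= eqxx mulr1n big1 ?addr0 // => g gu.
  by rewrite (negbTE gu) mulr0n mul0r.
rewrite -sum ?mem_undup ?inE ?eqxx ?orbT // -[RHS]sum ?mem_undup ?inE ?eqxx ?orbT //.
by rewrite e.
Qed.

(* With f the distance to a vertex, this bounds the length of a chain below. *)
Lemma cay_chain_affine f : (forall u v, cay_edge S u v -> `|f u - f v| <= 1) ->
  forall (x y : X) l, cay_chain x y l -> forall u v t u' v' t',
  bary x = edge_point u v t -> bary y = edge_point u' v' t' ->
  `|((1 - t) * f u + t * f v) - ((1 - t') * f u' + t' * f v')| <= l.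
Proof.
move=> lf x y l; elim=> {x y l} [x|x y z a b s s' l ab s01 s01' xab yab _ IH] u v t u' v' t' xe ye.
  rewrite (edge_point_affine f (t := t) (t' := t') (u := u) (v := v) (u' := u') (v' := v')) -?xe -?ye //.
  by rewrite subrr normr0.
have -> : (1 - t) * f u + t * f v = (1 - s) * f a + s * f b.
  by apply: edge_point_affine; rewrite -xe.
have := IH _ _ _ _ _ _ yab ye.
set q := (1 - t') * _ + _; set p := (1 - s') * _ + _ => pq.
have -> : (1 - s) * f a + s * f b - q = (s' - s) * (f a - f b) + (p - q).
  by rewrite /p; ring.
apply: le_trans (ler_normD _ _) (lerD _ pq).
by rewrite normrM distrC ler_piMr // lf.
Qed.

Lemma wdist_edge g u v : cay_edge S u v -> (wdist S g v <= (wdist S g u).+1)%N.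
Proof.
move=> e; apply: leq_trans (wdist_triangle S u g v) _.
by rewrite -addn1 leq_add2l; apply/wdist_leP; exists u.
Qed.

Lemma reach_chain n u v : reach S n u v -> cay_chain (vertex R S u) (vertex R S v) n%:R.
Proof.
elim: n v => [|n IH] v /=; first by move=> ->; exact: cay_chain0.
case=> w /IH c e; rewrite -addn1 natrD; apply: cay_chain_cat c _.
have -> : (1 : R) = `|0 - 1| + 0 by rewrite sub0r normrN1 addr0.
apply: (cay_chainS (y := vertex R S v) e) => /=; rewrite ?lexx ?ler01 //.
- by rewrite [RHS]edge_point0.
- by rewrite edge_point1.
- exact: cay_chain0.
Qed.

Lemma mdist_vertex u v : mdist (vertex R S u) (vertex R S v) = (wdist S u v)%:R.
Proof.
apply/eqP; rewrite eq_le; apply/andP; split.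
  by apply: cay_dist_le; apply: reach_chain; exact: wdist_reach.
apply: cay_dist_ge => l c.
have := @cay_chain_affine (fun g => (wdist S u g)%:R) _ _ _ _ c u u 0 v v 0 erefl erefl.
rewrite subr0 !mul1r !mul0r !addr0 wdistxx sub0r normrN normr_nat; apply=> a b e.
have := wdist_edge u e; have := wdist_edge u (cay_edge_sym e).
by rewrite -!(ler_nat R) -![in (_.+1)%:R]addn1 !natrD ler_norml; lra.
Qed.

Lemma near_vertex (x : X) : exists u, mdist x (vertex R S u) <= 1.
Proof.
have [u [v [t [e t01 xe]]]] := baryP x; exists u.
have c : cay_chain x (vertex R S u) (`|t - 0| + 0).
  apply: (cay_chainS (y := vertex R S u) e t01) => //=; rewrite ?lexx ?ler01 //.
    by rewrite [RHS]edge_point0.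
  exact: cay_chain0.
by apply: le_trans (cay_dist_le c) _; rewrite subr0 addr0 ler_norml; lra.
Qed.

End CayleyDistance.

(** * Lipschitz paths *)

Section LipschitzPaths.
Context (R : realType) (X : metricType R).
Implicit Types (f : R -> X) (a b C : R).

Definition lip C a f := forall s t, 0 <= s -> s <= t -> t <= a ->
  mdist (f s) (f t) <= C * (t - s).

Definition paste a f f' : R -> X := fun s => if s <= a then f s else f' (s - a).

Lemma lip_paste C a b f f' : 0 <= a -> lip C a f -> lip C b f' -> f a = f' 0 ->
  lip C (a + b) (paste a f f').
Proof.
move=> a0 lf lf' ff' s t s0 st tab; rewrite /paste.
have [ta|at'] := leP t a; first by rewrite (le_trans st ta); apply: lf.
have [sa|as'] := leP s a.
  apply: le_trans (metric_triangle _ (f a) _) _.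
  have -> : C * (t - s) = C * (a - s) + C * (t - a - 0) by ring.
  by apply: lerD; [apply: lf|rewrite ff'; apply: lf']; lra.
by have -> : t - s = (t - a) - (s - a) by [ring]; apply: lf'; lra.
Qed.

Lemma paste_right a b f f' : 0 <= b -> f a = f' 0 -> paste a f f' (a + b) = f' b.
Proof.
move=> b0 ff'; rewrite /paste; have [ab|_] := leP (a + b) a; last by rewrite addrC addKr.
by have -> : b = 0 by [lra]; rewrite addr0.
Qed.

Lemma lip_path C n a b f : 0 <= C -> 0 <= a -> a <= b -> b <= n -> lip C n f ->
  is_path `[a, b]%classic f.
Proof.
move=> C0 a0 ab bn lf; split.
  split; [|exact: interval_is_interval|exact: interval_closed].
  by exists a; rewrite /= in_itv /= lexx.
apply/subspace_continuousP => x /=; rewrite in_itv /= => /andP[ax xb].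
apply/metricType_numDomainType.cvgrPdist_lt => e e0; rewrite near_withinE.
exists (e / (C + 1)) => /=; first by rewrite divr_gt0 //; lra.
move=> y; rewrite /= => xy; rewrite in_itv /= => /andP[ay yb].
have xyC : C * `|x - y| < e.
  apply: (@le_lt_trans _ _ ((C + 1) * `|x - y|)).
    by rewrite ler_wpM2r //; lra.
  by rewrite mulrC -ltr_pdivlMr //; lra.
apply: le_lt_trans xyC; have [xley|/ltW yx] := leP x y.
  by rewrite distrC ger0_norm ?subr_ge0 //; apply: lf; lra.
by rewrite metric_sym ger0_norm ?subr_ge0 //; apply: lf; lra.
Qed.

(** Rounding a time down to an integer moves it by less than 1 and the point by at most C, so the
    lower bound has to be checked at integer times only. The integer part of a may precede a, which
    is why f is Lipschitz on all of [0, n]. *)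
Lemma lip_quasi_geodesic C A D n a b f : 0 <= C -> 0 <= A -> 0 <= D ->
  0 <= a -> a <= b -> b <= n -> lip C n f ->
  (forall i j : nat, (Num.truncn a <= i)%N -> (i <= j)%N -> (j <= Num.truncn b)%N ->
    (j - i)%:R <= A * mdist (f i%:R) (f j%:R) + D) ->
  quasi_geodesic (C + A + 1) (2 * C + D + 1) `[a, b]%classic f.
Proof.
move=> C0 A0 D0 a0 ab bn lf fA; split; first exact: lip_path lf.
have Q0 : 0 < C + A + 1 by lra.
suff H s t : a <= s -> s <= t -> t <= b ->
    (C + A + 1)^-1 * (t - s) - (2 * C + D + 1) <= mdist (f s) (f t) /\
    mdist (f s) (f t) <= (C + A + 1) * (t - s) + (2 * C + D + 1).
  move=> s t; rewrite /= !in_itv /= => /andP[as' sb] /andP[at' tb].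
  have [st|/ltW ts] := leP s t.
    by rewrite distrC ger0_norm ?subr_ge0 //; apply/andP; exact: H.
  by rewrite metric_sym ger0_norm ?subr_ge0 //; apply/andP; exact: H.
move=> as' st tb; have stC : mdist (f s) (f t) <= C * (t - s) by apply: lf; lra.
split; last first.
  apply: le_trans stC _.
  by have : 0 <= (A + 1) * (t - s) by [rewrite mulr_ge0 //; lra]; lra.
have s0 : 0 <= s by lra.
have t0 : 0 <= t by lra.
set i := Num.truncn s; set j := Num.truncn t.
have /andP[i1] := truncn_itv s0; rewrite -/i -addn1 natrD => i2.
have /andP[j1] := truncn_itv t0; rewrite -/j -addn1 natrD => j2.
have ij : (i <= j)%N by apply: le_truncn.
have := fA i j (le_truncn as') ij (le_truncn tb); rewrite natrB // => ijA.
have si : mdist (f i%:R) (f s) <= C.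
  have i0 : 0 <= i%:R :> R by exact: ler0n.
  apply: le_trans (lf _ _ i0 i1 _) _; first lra.
  by rewrite -[leRHS]mulr1 ler_wpM2l //; lra.
have tj : mdist (f j%:R) (f t) <= C.
  have j0 : 0 <= j%:R :> R by exact: ler0n.
  apply: le_trans (lf _ _ j0 j1 _) _; first lra.
  by rewrite -[leRHS]mulr1 ler_wpM2l //; lra.
have dij : mdist (f i%:R) (f j%:R) <= mdist (f s) (f t) + 2 * C.
  have := metric_triangle (f i%:R) (f s) (f j%:R).
  have := metric_triangle (f s) (f t) (f j%:R).
  rewrite (metric_sym (f t)); lra.
rewrite lerBlDr mulrC ler_pdivrMr //.
have Adij : A * mdist (f i%:R) (f j%:R) <= A * (mdist (f s) (f t) + 2 * C).
  by rewrite ler_wpM2l.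
have m0 := mdist_ge0 (f s) (f t).
have p1 : 0 <= (C + 1) * mdist (f s) (f t) by rewrite mulr_ge0 //; lra.
have p2 : 0 <= (C + A) * (2 * C + D + 1) by rewrite mulr_ge0 //; lra.
have p3 : 0 <= A * (D + 1) by rewrite mulr_ge0 //; lra.
nra.
Qed.

End LipschitzPaths.

(** * Interpolation of sequences by Lipschitz paths *)

Section Interpolation.
Context (R : realType) (G : groupType) (S : finGenSet G).
Local Notation X := (cayley R S).

Lemma edge_path (x y : X) u v t t' : cay_edge S u v -> 0 <= t <= 1 -> 0 <= t' <= 1 ->
  bary x = edge_point u v t -> bary y = edge_point u v t' ->
  exists f : R -> X, [/\ lip 1 `|t - t'| f, f 0 = x & f `|t - t'| = y].
Proof.
move=> e t01 t01' xe ye.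
(* Clamping to [0, 1] makes f total; on the interval of interest it is the identity. *)
pose clip (s : R) : R := Num.max 0 (Num.min s 1).
have clip01 s : 0 <= clip s <= 1.
  by rewrite /clip le_max lexx /= ge_max ler01 ge_min lexx orbT.
have pt s : exists u0 v0 t0, [/\ cay_edge S u0 v0, 0 <= t0 <= 1 &
    edge_point u v (clip s) = edge_point u0 v0 t0].
  by exists u, v, (clip s).
pose f s : X := CayPoint (pt (t + s * Num.sg (t' - t))).
have clipE s : 0 <= s <= 1 -> clip s = s.
  by rewrite /clip => /andP[s0 s1]; rewrite (min_l s1) max_r.
have sgd : `|t - t'| * Num.sg (t' - t) = t' - t by rewrite distrC mulrC -numEsg.
exists f; split.
- move=> s s' s0 ss' s'd; rewrite mul1r.
  have c : cay_chain (f s) (f s')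
      (`|clip (t + s * Num.sg (t' - t)) - clip (t + s' * Num.sg (t' - t))| + 0).
    by apply: (cay_chainS (y := f s') e (clip01 _) (clip01 _)) => //; exact: cay_chain0.
  apply: le_trans (cay_dist_le c) _; rewrite addr0.
  have rng r : 0 <= r <= `|t - t'| -> 0 <= t + r * Num.sg (t' - t) <= 1.
    rewrite distrC => /andP[r0]; have [tt'|t't] := ltP t t'.
      by rewrite gtr0_norm ?gtr0_sg ?subr_gt0 //; lra.
    move=> rd; case: (ltgtP t' t) t't => // [t't|->] _; last first.
      by rewrite subrr sgr0 mulr0 addr0.
    by move: rd; rewrite ltr0_norm ?ltr0_sg ?subr_lt0 //; lra.
  rewrite !clipE; [|by apply: rng; lra..].
  have -> : t + s * Num.sg (t' - t) - (t + s' * Num.sg (t' - t)) = (s - s') * Num.sg (t' - t) by ring.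
  rewrite normrM normr_sg distrC ger0_norm ?subr_ge0 // ler_piMr ?subr_ge0 //.
  by case: (_ != _).
- by apply: bary_inj; rewrite /= mul0r addr0 clipE.
- by apply: bary_inj; rewrite /= sgd addrC subrK clipE.
Qed.

Lemma chain_path (x y : X) l : cay_chain x y l ->
  exists f : R -> X, [/\ lip 1 l f, f 0 = x & f l = y].
Proof.
elim=> {x y l} [x|x y z u v t t' l e t01 t01' xe ye c [f' [lf' f'0 f'l]]].
  exists (fun=> x); split=> // s t s0 st t0; rewrite mdistxx mul1r; lra.
have [f [lf f0 fl]] := edge_path e t01 t01' xe ye.
have ff' : f `|t - t'| = f' 0 by rewrite fl f'0.
exists (paste `|t - t'| f f'); split.
- exact: lip_paste.
- by rewrite /paste normr_ge0.
- by rewrite paste_right // (cay_chain_ge0 c).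
Qed.

(** The distance is an infimum of chain lengths, so the strict inequality yields a chain shorter
    than C. It is run through at speed C within unit time, with a rest at its end. *)
Lemma interpolate (C : R) (z : nat -> X) n :
  (forall i, (i < n)%N -> mdist (z i) (z i.+1) < C) ->
  exists f : R -> X, lip C n%:R f /\ forall i, (i <= n)%N -> f i%:R = z i.
Proof.
elim: n => [|n IH] zC.
  exists (fun=> z 0%N); split=> [s t s0 st t0|]; last by case.
  by have -> : t - s = 0 by [lra]; rewrite mdistxx mulr0.
have [i ni|f [lf fz]] := IH; first by apply: zC; exact: ltnW.
have zn := zC n (ltnSn n).
have C0 : 0 <= C by apply: le_trans (ltW zn); exact: mdist_ge0.
have [l c lC] : exists2 l, cay_chain (z n) (z n.+1) l & l < C.
  by have [l c lC] := inf_lt (cay_connected (z n) (z n.+1)) zn; exists l.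
have [h [lh h0 hl]] := chain_path c.
have l0 := cay_chain_ge0 c.
pose h' s := h (Num.min (C * s) l).
have lh' : lip C 1 h'.
  move=> s t s0 st t1; have Cst : C * s <= C * t by rewrite ler_wpM2l.
  have Cs0 : 0 <= C * s by rewrite mulr_ge0.
  apply: le_trans (lh _ _ _ _ _) _; rewrite ?mul1r.
  - by rewrite le_min Cs0.
  - by rewrite le_min !ge_min Cst lexx !orbT.
  - by rewrite ge_min lexx orbT.
  - by rewrite mulrBr; case: (leP (C * t) l); case: (leP (C * s) l); lra.
have h'0 : h' 0 = z n by rewrite /h' mulr0 min_l.
have h'1 : h' 1 = z n.+1 by rewrite /h' mulr1 min_r // ltW.
have ff' : f n%:R = h' 0 by rewrite fz // h'0.
exists (paste n%:R f h'); split.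
  by rewrite -addn1 natrD; apply: lip_paste.
move=> i; rewrite leq_eqVlt => /orP[/eqP->|].
  by rewrite -addn1 natrD paste_right // h'1 addn1.
by rewrite ltnS => ni; rewrite /paste ler_nat ni fz.
Qed.

End Interpolation.

(** * Comparison of continuous and discrete quasi-geodesics *)

Section Discretisation.
Context (R : realType) (G : groupType) (S : finGenSet G).
Local Notation X := (cayley R S).
Local Notation vert := (vertex R S).
Implicit Types (x y : nat -> G) (gamma sigma : R -> X).

Lemma closed_nbhd_near (A : set X) (r : R) p : closed_nbhd A r p ->
  exists2 a, A a & mdist p a < r + 1.
Proof.
move=> /= pA; have [|_ [a Aa <-]] := @ereal_inf_lt _ [set (mdist p y)%:E | y in A] (r + 1)%:E.
  by apply: le_lt_trans pA _; rewrite lte_fin; lra.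
by rewrite lte_fin; exists a.
Qed.

Lemma near_closed_nbhd (A : set X) (r : R) p a : A a -> mdist p a <= r ->
  closed_nbhd A r p.
Proof.
move=> Aa pa; rewrite /closed_nbhd /=; apply: (@le_trans _ _ (mdist p a)%:E).
  by apply: ereal_inf_lbound; exists a.
by rewrite lee_fin.
Qed.

(** M is evaluated at the constants of the interpolated competitor. To this are added 1 for the
    infimum in [closed_nbhd], [lam + kap] for rounding a time to an integer, and e for rounding to a
    vertex. *)
Definition disc_gauge (M : R -> R -> R) (lam kap e : R) (c : nat) : nat :=
  let C := c%:R + e + 1 in
  (Num.truncn (M (C + c%:R + 1) (2 * C + (c%:R * (2 * e + 1) + 2) + 1)
     + 1 + lam + kap + e)).+1.

Lemma morse_dmorse M (lam kap e : R) n gamma x : 0 <= lam -> 0 <= e ->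
  (forall s t, 0 <= s -> s <= t -> t <= n%:R ->
     mdist (gamma s) (gamma t) <= lam * (t - s) + kap) ->
  (forall i, (i <= n)%N -> mdist (gamma i%:R) (vert (x i)) <= e) ->
  morse M `[0, n%:R]%classic gamma ->
  dmorse S (disc_gauge M lam kap e) 0 n x.
Proof.
move=> lam0 e0 lg gx mg p q _ pq qn c m y qy y0 ym l lm.
rewrite /disc_gauge; set C := c%:R + e + 1; set Q := C + _ + 1; set D := _ + 2.
have c0 : 0 <= c%:R :> R by exact: ler0n.
(* The points of gamma at times p and q are put before and after y, because [morse] asks for exact
   endpoints; [y l] is therefore reached at time l + 1. *)
pose z i : X := if i is i'.+1 then if (i' <= m)%N then vert (y i') else gamma q%:R
  else gamma p%:R.
have zC i : (i < m.+2)%N -> mdist (z i) (z i.+1) < C.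
  case: i => [_|i] /=; first by rewrite y0; apply: le_lt_trans (gx _ _) _; [lia|rewrite /C; lra].
  rewrite !ltnS => im; rewrite im; case: ltnP => [i1m|mi].
    rewrite mdist_vertex; have [|||le _] := qy i i.+1; [lia..|].
    have : (wdist S (y i) (y i.+1))%:R <= c%:R :> R by rewrite ler_nat; lia.
    by rewrite /C; lra.
  have -> : i = m by lia.
  by rewrite ym metric_sym; apply: le_lt_trans (gx _ qn) _; rewrite /C; lra.
have [f [lf fz]] := interpolate zC.
(* The index of a vertex within e of [z i]. Index gaps shrink by at most 2, one at each end, whence
   the 2 in D. *)
pose k i := minn i.-1 m.
have zk i : (i <= m.+2)%N -> mdist (z i) (vert (y (k i))) <= e.
  case: i => [_|i im].
    by rewrite (_ : k 0%N = 0%N) ?y0; [apply: gx|rewrite /k min0n]; lia.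
  have [mi|im'] := ltnP m i.
    have -> : k i.+1 = m by rewrite /k; lia.
    by rewrite ym /= leqNgt mi; apply: gx.
  have -> : k i.+1 = i by rewrite /k; lia.
  by rewrite /= im' mdistxx.
have C0 : 0 <= C by rewrite /C; lra.
have D0 : 0 <= D by rewrite /D addr_ge0 // mulr_ge0 //; lra.
have m0 : 0 <= m.+2%:R :> R by exact: ler0n.
have fQ : quasi_geodesic Q (2 * C + D + 1) `[0, m.+2%:R]%classic f.
  apply: lip_quasi_geodesic lf _ => // i j _ ij; rewrite natrK => jm.
  rewrite !fz //; last lia.
  have im : (i <= m.+2)%N by lia.
  have [|||_ le] := qy (k i) (k j); [rewrite /k; lia..|].
  have : (j - i <= c * (wdist S (y (k i)) (y (k j))).+1 + 2)%N by rewrite /k in le *; lia.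
  rewrite -(ler_nat R) natrD natrM -addn1 natrD -mdist_vertex => lij.
  have zi := zk i im; have zj := zk j jm; rewrite metric_sym in zi.
  have t1 := metric_triangle (vert (y (k i))) (z i) (vert (y (k j))).
  have t2 := metric_triangle (z i) (z j) (vert (y (k j))).
  have : c%:R * mdist (vert (y (k i))) (vert (y (k j))) <= c%:R * (mdist (z i) (z j) + 2 * e).
    by rewrite ler_wpM2l //; lra.
  by rewrite /D; lra.
have p0 : 0 <= p%:R :> R by exact: ler0n.
have pqR : p%:R <= q%:R :> R by rewrite ler_nat.
have qnR : q%:R <= n%:R :> R by rewrite ler_nat.
have Q1 : 1 <= Q by rewrite /Q; lra.
have q0 : 0 <= 2 * C + D + 1 by lra.
have im : (f @` `[0, m.+2%:R]) (vert (y l)).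
  exists l.+1%:R; last by rewrite fz ?ltnS //= ?lm // leqW.
  by rewrite /= in_itv /= ler0n ler_nat ltnS leqW.
have in01 (s : R) : 0 <= s -> s <= n%:R -> `[0, n%:R]%classic s.
  by move=> s0 sn; rewrite /= in_itv /= s0 sn.
have f0 : f 0 = gamma p%:R by rewrite -[0]/(0%:R) fz.
have fm : f m.+2%:R = gamma q%:R by rewrite fz //= ltnn.
have := mg _ _ (in01 p%:R p0 (le_trans pqR qnR)) (in01 q%:R (le_trans p0 pqR) qnR) pqR
   Q _ Q1 q0 _ _ _ m0 fQ f0 fm _ im.
move=> /closed_nbhd_near[_ [s + <-] ds]; rewrite /= in_itv /= => /andP[ps sq].
have s0 := le_trans p0 ps.
have /andP[j1] := truncn_itv s0; rewrite -addn1 natrD; set j := Num.truncn s in j1 * => j2.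
have pj : (p <= j)%N by rewrite truncn_ge_nat.
have jq : (j <= q)%N by rewrite -(ler_nat R); apply: le_trans sq.
exists j; first by rewrite pj.
rewrite -(ler_nat R) -mdist_vertex; apply: ltW; apply: lt_trans (truncnS_gt _).
have j0 : 0 <= j%:R :> R by exact: ler0n.
have := lg j%:R s j0 j1 (le_trans sq qnR); have := gx j (leq_trans jq qn).
have := metric_triangle (vert (y l)) (gamma s) (vert (x j)).
have := metric_triangle (gamma s) (gamma j%:R) (vert (x j)).
rewrite (metric_sym (gamma s) (gamma j%:R)).
have : lam * (s - j%:R) <= lam * 1 by rewrite ler_wpM2l //; lra.
rewrite mulr1; lra.
Qed.

Definition sample_const (Q q E : R) : nat :=
  (Num.truncn (Q * (2 * E + q + 1) + 1 + q)).+1.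

Lemma sample (Q q E a b : R) sigma u v : 1 <= Q -> 0 <= q -> 1 <= E -> a <= b ->
  quasi_geodesic Q q `[a, b]%classic sigma ->
  mdist (sigma a) (vert u) <= E -> mdist (sigma b) (vert v) <= E ->
  exists m y, [/\ qgeod S (sample_const Q q E) 0 m y, y 0%N = u, y m = v &
    forall s, a <= s <= b -> exists2 l, (l <= m)%N & mdist (sigma s) (vert (y l)) <= Q + q + E].
Proof.
move=> Q1 q0 E1 ab [_ sQ] su sv.
have ba0 : 0 <= b - a by lra.
(* Unit steps starting at a, with the last one cut off at b. *)
pose tau i : R := Num.min (a + i%:R) b.
have [m m1 m2] : exists2 m : nat,
    forall i, (i <= m)%N -> i%:R <= b - a & b - a < m.+1%:R.
  have /andP[t1 t2] := truncn_itv ba0; exists (Num.truncn (b - a)) => // i im.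
  by apply: le_trans t1; rewrite ler_nat.
have /choice[w wP] : forall i : nat, exists w, mdist (sigma (tau i)) (vert w) <= 1.
  by move=> i; exact: near_vertex.
pose y i := if i is 0%N then u else if (i < m.+1)%N then w i else v.
have tau0 : tau 0%N = a by rewrite /tau addr0 min_l.
have taum : tau m.+1 = b by rewrite /tau min_r //; lra.
have ab_tau i : `[a, b]%classic (tau i).
  by rewrite /= in_itv /= /tau le_min ab ge_min lexx orbT andbT lerDl ler0n.
have yE i : (i <= m.+1)%N -> mdist (sigma (tau i)) (vert (y i)) <= E.
  case: i => [|i] im; first by rewrite tau0.
  rewrite /y; case: ltnP => mi; first by apply: le_trans (wP _) _.
  by have -> : i.+1 = m.+1 by [apply/eqP; rewrite eqn_leq im mi]; rewrite taum.
have tauE i : (i <= m)%N -> tau i = a + i%:R.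
  by move=> /m1 im; rewrite /tau min_l //; lra.
exists m.+1, y; split=> //.
- move=> i j _ ij jm; have [->|nij] := eqVneq i j.
    by rewrite wdistxx subnn !muln0; split.
  have ltij : (i < j)%N by rewrite ltn_neqAle nij.
  have im : (i <= m)%N by rewrite -ltnS; exact: leq_trans ltij jm.
  have := sQ _ _ (ab_tau i) (ab_tau j); rewrite tauE //.
  have tj1 : tau j <= a + j%:R by rewrite /tau ge_min lexx.
  have tj2 : a + j%:R - 1 <= tau j.
    case: j {ij nij tj1} ltij jm => // j _ /m1 jm.
    by rewrite -addn1 natrD /tau le_min; lra.
  have ijR : i%:R + 1 <= j%:R :> R by rewrite -[1]/(1%:R) -natrD ler_nat addn1.
  rewrite distrC ger0_norm; last lra.
  move=> /andP[lo hi].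
  have yi := yE i (leqW im); have yj := yE j jm; rewrite tauE // in yi.
  have t1 := metric_triangle (vert (y i)) (sigma (a + i%:R)) (vert (y j)).
  have t2 := metric_triangle (sigma (a + i%:R)) (sigma (tau j)) (vert (y j)).
  have t3 := metric_triangle (sigma (a + i%:R)) (vert (y i)) (sigma (tau j)).
  have t4 := metric_triangle (vert (y i)) (vert (y j)) (sigma (tau j)).
  rewrite (metric_sym (vert (y i)) (sigma (a + i%:R))) in t1.
  rewrite (metric_sym (vert (y j)) (sigma (tau j))) in t4.
  rewrite mdist_vertex in t1 t4.
  have cE : Q * (2 * E + q + 1) + 1 + q < (sample_const Q q E)%:R by exact: truncnS_gt.
  have QE : 2 * E + q + 1 <= Q * (2 * E + q + 1) by rewrite ler_peMl //; lra.
  have QE' : Q * (2 * E + q) + Q = Q * (2 * E + q + 1) by ring.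
  have D0 : 0 <= (wdist S (y i) (y j))%:R :> R by exact: ler0n.
  have QQ : (2 * E + q) <= Q * (2 * E + q) by rewrite ler_peMl //; lra.
  set c := sample_const Q q E in cE *; set dd := wdist S (y i) (y j) in t1 t4 D0 *.
  split; rewrite -(ler_nat R) natrM natrB //.
    have h1 : Q * (tau j - (a + i%:R)) <= Q * (j%:R - i%:R) by rewrite ler_wpM2l //; lra.
    have h2 : Q + q + 2 * E <= c%:R by lra.
    have h3 : (Q + q + 2 * E) * (j%:R - i%:R) <= c%:R * (j%:R - i%:R) by rewrite ler_wpM2r //; lra.
    have h4 : q + 2 * E <= (q + 2 * E) * (j%:R - i%:R) by rewrite ler_peMr //; lra.
    lra.
  have h1 : Q^-1 * (tau j - (a + i%:R)) <= dd%:R + 2 * E + q by lra.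
  rewrite ler_pdivrMl in h1; last lra.
  have h2 : c%:R * dd.+1%:R = c%:R * dd%:R + c%:R :> R by rewrite -addn1 natrD mulrDr mulr1.
  have h3 : Q * dd%:R <= c%:R * dd%:R by rewrite ler_wpM2r //; lra.
  lra.
- by rewrite /y ltnn.
move=> s /andP[sa sb]; have sa0 : 0 <= s - a by lra.
have /andP[l1] := truncn_itv sa0; rewrite -addn1 natrD; set l := Num.truncn (s - a) in l1 * => l2.
have lm : (l <= m)%N by rewrite -ltnS -(ltr_nat R); lra.
exists l; first exact: leqW.
have := yE l (leqW lm); rewrite tauE // => yl.
have sI : `[a, b]%classic s by rewrite /= in_itv /= sa sb.
have := sQ _ _ sI (ab_tau l); rewrite tauE // => /andP[_].
rewrite ger0_norm; last lra.
have : Q * (s - (a + l%:R)) <= Q * 1 by rewrite ler_wpM2l //; lra.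
have := metric_triangle (sigma s) (sigma (a + l%:R)) (vert (y l)); lra.
Qed.

End Discretisation.

(** * Discrete forms of stability and of the local-to-global property *)

Section FromContinuous.
Context (R : realType) (G : groupType) (S : finGenSet G).
Local Notation X := (cayley R S).
Local Notation vert := (vertex R S).

Lemma wdist_eq0 (u v : G) : wdist S u v = 0%N -> u = v.
Proof. by move=> uv; have /wdist_leP : (wdist S u v <= 0)%N by rewrite uv. Qed.

Lemma stable_stable_paths (H : groupClosed G) : stable R S H ->
  exists N r alpha, stable_paths S H N r alpha.
Proof.
move=> [M [r [Mg r0 st]]].
(* In r + 2, one unit is for rounding to a vertex and one for the infimum in [closed_nbhd]. *)
pose N := disc_gauge M 1 0 1; pose r' := (Num.truncn (r + 2)).+1.
suff /choice[alpha alphaP] : forall h, exists x : nat -> G, h \in H ->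
    [/\ x 0%N = 1%g, x (wlen S h) = h,
      forall i j, (i <= j <= wlen S h)%N ->
        (wdist S (x i) (x j) <= j - i + 2)%N /\ (j - i <= wdist S (x i) (x j) + 2)%N,
      dmorse S N 0 (wlen S h) x &
      forall i, (i <= wlen S h)%N -> exists2 k, k \in H & (wdist S (x i) k <= r')%N].
  by exists N, r', alpha.
move=> h; have [hH|] := boolP (h \in H); last by exists (fun=> 1%g).
have [b [gamma [b0 [_ gd] gm [g0 gb] gH]]] := st 1%g h gpred1 hH.
have in0b (s : R) : 0 <= s -> s <= b -> `[0, b]%classic s.
  by move=> s0 sb; rewrite /= in_itv /= s0 sb.
have bE : b = (wlen S h)%:R.
  have := gd 0 b (in0b 0 (lexx _) b0) (in0b b b0 (lexx _)).
  by rewrite g0 gb mdist_vertex sub0r normrN ger0_norm.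
set n := wlen S h in bE *.
have /choice[w wP] : forall i : nat, exists w, mdist (gamma i%:R) (vert w) <= 1.
  by move=> i; exact: near_vertex.
pose x i := if i is 0%N then 1%g else if (i < n)%N then w i else h.
have xn : x n = h.
  rewrite /x; case nE: n => [|n']; last by rewrite ltnn.
  by apply: wdist_eq0; exact: nE.
have gx i : (i <= n)%N -> mdist (gamma i%:R) (vert (x i)) <= 1.
  case: i => [|i] im; first by rewrite g0 mdistxx.
  rewrite /x; case: ltnP => // ni; have -> : i.+1 = n by lia.
  by rewrite -bE gb mdistxx.
have in0n i : (i <= n)%N -> `[0, b]%classic (i%:R : R).
  by move=> im; apply: in0b; [exact: ler0n|rewrite bE ler_nat].
exists x => _; split=> //.
- move=> i j /andP[ij jn]; have im := leq_trans ij jn.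
  have := gd _ _ (in0n i im) (in0n j jn).
  rewrite distrC ger0_norm ?subr_ge0 ?ler_nat // => gij.
  have xi := gx i im; have xj := gx j jn.
  have t1 := metric_triangle (vert (x i)) (gamma i%:R) (vert (x j)).
  have t2 := metric_triangle (gamma i%:R) (gamma j%:R) (vert (x j)).
  have t3 := metric_triangle (gamma i%:R) (vert (x i)) (gamma j%:R).
  have t4 := metric_triangle (vert (x i)) (vert (x j)) (gamma j%:R).
  rewrite (metric_sym (vert (x i)) (gamma i%:R)) mdist_vertex in t1.
  rewrite (metric_sym (vert (x j)) (gamma j%:R)) mdist_vertex in t4.
  by split; rewrite -(ler_nat R) natrD natrB //; lra.
- apply: (morse_dmorse (gamma := gamma)) => //; rewrite -?bE //.
  move=> s t s0 st' tb; rewrite gd; [|apply: in0b; lra..].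
  by rewrite mul1r addr0 distrC ger0_norm ?subr_ge0.
move=> i im; have : closed_nbhd (vert @` [set` H]) r (gamma i%:R).
  by apply: gH; exists i%:R => //; exact: in0n.
move=> /closed_nbhd_near[_ [k kH <-] dk]; exists k => //.
rewrite -(ler_nat R) -mdist_vertex; apply: ltW; apply: lt_trans (truncnS_gt _).
have := metric_triangle (vert (x i)) (gamma i%:R) (vert k).
rewrite (metric_sym _ (gamma i%:R)); have := gx i im; lra.
Qed.

(** The terms are the distances from the competitor to its sample, from the sample to x by the
    discrete Morse property, and from x to f. *)
Definition loc_gauge (c : nat) (N : nat -> nat) (Q q : R) : R :=
  Q + q + (c%:R + 1) + (N (sample_const Q q (c%:R + 1)))%:R + (c%:R + 1).

Lemma dmorse_morse c N n (x : nat -> G) (f : R -> X) (a b : R) :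
  lip (c%:R + 1) n%:R f -> (forall i, (i <= n)%N -> f i%:R = vert (x i)) ->
  0 <= a -> a <= b -> b <= n%:R ->
  dmorse S N (Num.truncn a) (Num.truncn b) x ->
  morse (loc_gauge c N) `[a, b]%classic f.
Proof.
move=> lf fx a0 ab bn mx s t; rewrite /= !in_itv /= => /andP[as' sb] /andP[at' tb] st.
move=> Q q Q1 q0 a' b' sigma ab' sQ s0 s1.
have c0 : 0 <= c%:R :> R by exact: ler0n.
have near (u : R) : a <= u -> u <= b -> mdist (f u) (vert (x (Num.truncn u))) <= c%:R + 1.
  move=> au ub; have u0 := le_trans a0 au.
  have /andP[u1 u2] := truncn_itv u0; rewrite -addn1 natrD in u2.
  have un : (Num.truncn u <= n)%N by rewrite -(ler_nat R); apply: le_trans u1 (le_trans ub bn).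
  rewrite -fx // metric_sym; have j0 : 0 <= (Num.truncn u)%:R :> R by exact: ler0n.
  apply: le_trans (lf _ _ j0 u1 (le_trans ub bn)) _.
  by rewrite -[leRHS]mulr1 ler_wpM2l //; lra.
have E1 : 1 <= c%:R + 1 :> R by lra.
have [||m [y [qy y0 ym ynear]]] := sample Q1 q0 E1 ab' sQ (u := x (Num.truncn s)) (v := x (Num.truncn t)).
- by rewrite s0; apply: near.
- by rewrite s1; apply: near.
move=> _ [u + <-]; rewrite /= in_itv /= => uab; have [l lm dl] := ynear u uab.
have [|||k /andP[sk kt] dk] := mx (Num.truncn s) (Num.truncn t) _ _ _ _ _ _ qy y0 ym l lm;
  [exact: le_truncn..|].
rewrite -(ler_nat R) -mdist_vertex in dk.
have s0' := le_trans a0 as'; have t0' := le_trans a0 at'.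
have /andP[t1 _] := truncn_itv t0'.
have kt' : k%:R <= t by apply: le_trans t1; rewrite ler_nat.
(* The index k is at least the integer part of s, yet may precede s itself; then it equals that
   integer part and [f s] replaces the value at k. *)
have [ks|sk'] := leP k%:R s.
  have kE : k = Num.truncn s by apply/eqP; rewrite eqn_leq sk truncn_ge_nat // ks.
  apply: (near_closed_nbhd (a := f s)); first by exists s; rewrite //= in_itv /= lexx.
  have := near s as' sb; rewrite kE in dk.
  have := metric_triangle (sigma u) (vert (y l)) (f s).
  have := metric_triangle (vert (y l)) (vert (x (Num.truncn s))) (f s).
  by rewrite (metric_sym (f s)) /loc_gauge; lra.
apply: (near_closed_nbhd (a := f k%:R)).
  by exists k%:R; rewrite //= in_itv /= (ltW sk') kt'.
have := metric_triangle (sigma u) (vert (y l)) (f k%:R).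
rewrite fx; last by rewrite -(ler_nat R); apply: le_trans kt' (le_trans tb bn).
by rewrite /loc_gauge; lra.
Qed.

Lemma MLTG_local_to_global : MLTG X -> local_to_global S.
Proof.
move=> mltg c N.
have c0 : 0 <= c%:R :> R by exact: ler0n.
pose lam : R := (c%:R + 1) + c%:R + 1; pose kap : R := 2 * (c%:R + 1) + c%:R + 1.
have [|||L [lam' [kap' [M' [[L0 lam1 kap0 M'g] glob]]]]] := mltg lam kap (loc_gauge c N).
- by rewrite /lam; lra.
- by rewrite /kap; lra.
- by move=> Q q Q1 q0; rewrite /loc_gauge; have := ler0n R (N (sample_const Q q (c%:R + 1))); lra.
(* This covers a window of length L after its ends are rounded to integers, and also pairs of
   consecutive points, so that the path can be interpolated. *)
exists (Num.truncn L + 2)%N, (Num.truncn (lam' * (1 + kap') + kap')).+1,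
  (disc_gauge M' lam' kap' 0) => n x loc.
have [f [lf fx]] : exists f : R -> X, lip (c%:R + 1) n%:R f /\
    forall i, (i <= n)%N -> f i%:R = vert (x i).
  apply: (interpolate (z := fun i => vert (x i))) => i im.
  rewrite mdist_vertex; have [||qx _] := loc i i.+1; [lia..|].
  have [|||le _] := qx i i.+1; [lia..|].
  have : (wdist S (x i) (x i.+1))%:R <= c%:R :> R by rewrite ler_nat; lia.
  lra.
have n0 : 0 <= n%:R :> R by exact: ler0n.
have cp : 0 <= c%:R + 1 :> R by lra.
have [||[_ fQ] fM] := glob `[0, n%:R]%classic f.
- exact: lip_path lf.
- move=> a b; rewrite /= !in_itv /= => /andP[a0 an] /andP[b0 bn] ab baL.
  have /andP[a1 a2] := truncn_itv a0; have /andP[b1 b2] := truncn_itv b0.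
  have L2 := truncnS_gt L.
  have tab : (Num.truncn a <= Num.truncn b)%N by apply: le_truncn.
  have tbn : (Num.truncn b <= n)%N by rewrite -(ler_nat R); apply: le_trans b1 bn.
  have [||qx mx] := loc (Num.truncn a) (Num.truncn b).
  + by rewrite tab.
  + rewrite leq_subLR -(ler_nat R) !natrD.
    by rewrite -addn1 natrD in a2; rewrite -addn1 natrD in L2; lra.
  split; last exact: dmorse_morse lf fx a0 ab bn mx.
  apply: lip_quasi_geodesic lf _ => // i j ai ij jb.
  have jn := leq_trans jb tbn; have im := leq_trans ij jn.
  rewrite (fx i im) (fx j jn); have [_ le] := qx i j ai ij jb.
  by move: le; rewrite -(ler_nat R) natrM -addn1 natrD mdist_vertex mulrDr mulr1.
split; last first.
  apply: (morse_dmorse (gamma := f)) fM => //; first lra.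
    move=> s t s0 st tn; have := fQ s t; rewrite /= !in_itv /= => /(_ _ _)/andP[].
    + by apply/andP; split; lra.
    + by apply/andP; split; lra.
    by move=> _; rewrite distrC ger0_norm ?subr_ge0.
  by move=> i im; rewrite fx // mdistxx.
move=> p q _ pq qn; have [->|/eqP npq] := eqVneq p q.
  by rewrite wdistxx subnn !muln0; split.
have := fQ p%:R q%:R; rewrite /= !in_itv /= !ler0n !ler_nat (leq_trans pq qn) qn.
move=> /(_ isT isT); rewrite !fx //; last lia.
have pqR : p%:R + 1 <= q%:R :> R by rewrite -[1]/(1%:R) -natrD ler_nat; lia.
rewrite mdist_vertex distrC ger0_norm; last lra.
set dd := wdist _ _ _; set c1 := (Num.truncn _).+1; move=> /andP[lo hi].
have c1E : lam' * (1 + kap') + kap' < c1%:R by exact: truncnS_gt.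
have d0 : 0 <= dd%:R :> R by exact: ler0n.
have lk : kap' <= lam' * kap' by rewrite ler_peMl.
split; rewrite -(ler_nat R) natrM natrB //.
  have : (lam' + kap') * (q%:R - p%:R) <= c1%:R * (q%:R - p%:R) by rewrite ler_wpM2r //; lra.
  have : kap' <= kap' * (q%:R - p%:R) by rewrite ler_peMr //; lra.
  lra.
have h1 : lam'^-1 * (q%:R - p%:R) <= dd%:R + kap' by lra.
rewrite ler_pdivrMl in h1; last lra.
have h2 : c1%:R * dd.+1%:R = c1%:R * dd%:R + c1%:R :> R by rewrite -addn1 natrD mulrDr mulr1.
have h3 : lam' * dd%:R <= c1%:R * dd%:R by rewrite ler_wpM2r //; lra.
lra.
Qed.

End FromContinuous.

(** * Independence of the generating set *)

Section ChangeGenerators.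
Local Open Scope nat_scope.
Context (G : groupType).

Lemma wdist_bilipschitz (S T : finGenSet G) : exists C,
  forall u v, wdist T u v <= C * wdist S u v.
Proof.
have [||C CP] := @finite_uniform G (gens S) (fun s n => wlen T s <= n) (gens_finite S).
- by move=> s _; exists (wlen T s).
- by move=> s n m nm sn; exact: leq_trans nm.
exists C => u v; have := wdist_reach S u v; move: (wdist S u v) => n.
elim: n v => [|n IH] v /=; first by move->; rewrite wdistxx.
case=> w /IH uw e; rewrite mulnS addnC; apply: leq_trans (wdist_triangle T w u v) _.
rewrite leq_add //; case: e => [->|[s Ss [->|->]]]; first by rewrite wdistxx.
  by rewrite wdist_mulr; exact: CP.
by rewrite wdist_mull1; exact: CP.
Qed.

Lemma local_to_global_gens (S T : finGenSet G) : local_to_global T -> local_to_global S.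
Proof.
move=> ltg c N; have [A AP] := wdist_bilipschitz S T; have [B BP] := wdist_bilipschitz T S.
pose C := (A + B).+1.
have TS u v : wdist T u v <= C * wdist S u v by apply: leq_trans (AP u v) _; rewrite leq_mul2r /C; lia.
have ST u v : wdist S u v <= C * wdist T u v by apply: leq_trans (BP u v) _; rewrite leq_mul2r /C; lia.
have change (U V : finGenSet G) e i j x : (forall u v, wdist V u v <= C * wdist U u v) ->
    (forall u v, wdist U u v <= C * wdist V u v) -> qgeod U e i j x -> qgeod V (C * e) i j x.
  move=> VU UV qx p q ip pq qj; have [le ge] := qx p q ip pq qj; split.
    by apply: leq_trans (VU _ _) _; rewrite -mulnA leq_mul2l le orbT.
  apply: leq_trans ge _; rewrite [C * e]mulnC -mulnA leq_mul2l; apply/orP; right.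
  by have := UV (x p) (x q); rewrite mulnS /C; lia.
(* A competitor for V with constant e is one for U with constant C * e, and the resulting distance
   is converted back with another factor C. *)
have changeM (U V : finGenSet G) M i j x : (forall u v, wdist V u v <= C * wdist U u v) ->
    (forall u v, wdist U u v <= C * wdist V u v) -> dmorse U M i j x ->
    dmorse V (fun e => C * M (C * e)) i j x.
  move=> VU UV mx p q ip pq qj e m y qy y0 ym l lm.
  have [k kpq dk] := mx p q ip pq qj _ _ _ (change _ _ _ _ _ _ UV VU qy) y0 ym l lm.
  by exists k => //; apply: leq_trans (VU _ _) _; rewrite leq_mul2l dk orbT.
have [L [c1 [N1 glob]]] := ltg (C * c) (fun e => C * N (C * e)).
exists L, (C * c1), (fun e => C * N1 (C * e)) => n x loc.
have [|qx mx] := glob n x.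
  by move=> i j ijn ijL; have [qx mx] := loc i j ijn ijL; split; [exact: change qx|exact: changeM mx].
by split; [exact: change qx|exact: changeM mx].
Qed.

End ChangeGenerators.

(** * Growth *)

Section GrowthRate.
Context (R : realType).
Implicit Types (u : nat -> R) (q rho mu B : R).

Lemma bernoulli q n : -1 <= q -> 1 + n%:R * q <= (1 + q) ^+ n.
Proof.
move=> q1; elim: n => [|n IH]; first by rewrite mul0r addr0.
rewrite exprS; apply: le_trans (ler_wpM2l _ IH); last lra.
have -> : (1 + q) * (1 + n%:R * q) = 1 + n.+1%:R * q + n%:R * q ^+ 2.
  by rewrite -addn1 natrD; ring.
by rewrite lerDl mulr_ge0 // sqr_ge0.
Qed.

Lemma expr_unbounded q B : 1 < q -> exists n, forall m, (n <= m)%N -> B <= q ^+ m.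
Proof.
move=> q1; exists (Num.truncn (B / (q - 1))).+1 => m nm.
have -> : q = 1 + (q - 1) by ring.
have q1' : -1 <= q - 1 by lra.
apply: le_trans (bernoulli m q1').
have := truncnS_gt (B / (q - 1)); rewrite ltr_pdivrMr ?subr_gt0 // => lt.
have : (Num.truncn (B / (q - 1))).+1%:R * (q - 1) <= m%:R * (q - 1).
  by rewrite ler_wpM2r ?ler_nat //; lra.
lra.
Qed.

Definition rate u : \bar R := limn_esup (fun n : nat => (u n `^ n%:R^-1)%:E).

Lemma rateE u :
  rate u = ereal_inf (range (esups (fun n : nat => (u n `^ n%:R^-1)%:E))).
Proof.
by rewrite /rate limn_esup_lim; apply/cvg_lim => //; exact: cvg_esups_inf.
Qed.

Lemma root_exprK x n : 0 <= x -> (0 < n)%N -> (x `^ n%:R^-1) ^+ n = x :> R.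
Proof.
move=> x0 n0; rewrite -powR_mulrn ?powR_ge0 // -powRrM mulVf ?pnatr_eq0 -?lt0n //.
by rewrite powRr1.
Qed.

Lemma rate_le u B rho : (forall n, 0 <= u n) -> 0 < rho ->
  (forall n, u n <= B * rho ^+ n) -> (rate u <= rho%:E)%E.
Proof.
move=> u0 rho0 uB; apply/lee_addgt0Pr => e e0.
(* Powers of this ratio eventually absorb the factor B. *)
have q1 : 1 < (rho + e) / rho by rewrite ltr_pdivlMr // mul1r; lra.
have [n nB] := expr_unbounded B q1; rewrite rateE.
apply: (@le_trans _ _ (esups (fun n : nat => (u n `^ n%:R^-1)%:E) n.+1)).
  by apply: ereal_inf_lbound; exists n.+1.
apply: ge_ereal_sup => _ [m /= nm <-]; rewrite -EFinD lee_fin.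
have um : u m <= (rho + e) ^+ m.
  apply: le_trans (uB m) _; have := nB m (ltnW nm).
  by rewrite expr_div_n ler_pdivlMr ?exprn_gt0.
have m0 : (0 < m)%N by apply: leq_ltn_trans nm.
rewrite -(@ler_pXn2r _ m) ?nnegrE ?powR_ge0 //; last lra.
by rewrite root_exprK.
Qed.

Lemma rate_ge1 u : (forall n, 1 <= u n) -> (1 <= rate u)%E.
Proof.
move=> u1; rewrite rateE; apply: le_ereal_inf_tmp => _ [n _ <-].
apply: (@le_trans _ _ (u n `^ n%:R^-1)%:E).
  have := @ge0_ler_powR _ (n%:R^-1 : R) _ 1 (u n); rewrite powR1 !nnegrE lee_fin.
  apply; rewrite ?invr_ge0 ?ler0n ?ler01 ?(le_trans ler01) ?u1 //.
by apply: ereal_sup_ubound; exists n => //=.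
Qed.

Lemma rate_lt u mu : (forall n, 0 <= u n) -> (rate u < mu%:E)%E ->
  exists n, forall m, (n <= m)%N -> u m <= mu ^+ m.
Proof.
move=> u0; rewrite rateE => /ereal_inf_lt[_ [n _ <-] lt].
exists n.+1 => m nm; have m0 : (0 < m)%N by apply: leq_ltn_trans nm.
have : ((u m `^ m%:R^-1)%:E < mu%:E)%E.
  by apply: le_lt_trans lt; apply: ereal_sup_ubound; exists m => //=; exact: ltnW.
rewrite lte_fin => /ltW le; rewrite -[leLHS](root_exprK (u0 m) m0).
by rewrite lerXn2r ?nnegrE ?powR_ge0 //; apply: le_trans le; exact: powR_ge0.
Qed.

End GrowthRate.

(** * Fekete's argument for shifted submultiplicative sequences *)

Section Submultiplicative.
Context (R : realType) (a : nat -> nat) (r : nat).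
Hypothesis a1 : forall n, (0 < a n)%N.
Hypothesis a_mono : forall n m, (n <= m)%N -> (a n <= a m)%N.
Hypothesis a_sub : forall n m, (a (n + m) <= a (n + r) * a (m + r))%N.
Let ratea := rate (fun n => (a n)%:R : R).
(** The shift by 2r restores exact submultiplicativity. *)
Let b n := a (n + 2 * r).

Let b_sub n m : (b (n + m) <= b n * b m)%N.
Proof.
have := a_sub (n + r) (m + r); rewrite /b.
have -> : (n + r + (m + r) = n + m + 2 * r)%N by lia.
have -> : (n + r + r = n + 2 * r)%N by lia.
by have -> : (m + r + r = m + 2 * r)%N by lia.
Qed.

Let a_le m n : (0 < m)%N -> (a n <= b m * b m ^ (n %/ m))%N.
Proof.
move=> m0; apply: (@leq_trans (b n)); first by apply: a_mono; lia.
rewrite {1}(divn_eq n m); elim: (n %/ m)%N => [|k IH].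
  by rewrite expn0 muln1; apply: a_mono; rewrite leq_add2r ltnW // ltn_pmod.
rewrite mulSn -addnA; apply: leq_trans (b_sub _ _) _.
by rewrite expnS leq_mul2l IH orbT.
Qed.

Let rate_root m : (0 < m)%N -> (ratea <= ((b m)%:R `^ m%:R^-1)%:E)%E.
Proof.
move=> m0; set rho := _ `^ _; have b1 : (0 < b m)%N by exact: a1.
have rhom : rho ^+ m = (b m)%:R by rewrite root_exprK.
have rho1 : 1 <= rho.
  rewrite -(@ler_pXn2r _ m) ?nnegrE ?powR_ge0 // expr1n rhom.
  by rewrite ler1n.
apply: (@rate_le _ _ (b m)%:R) => [n||n]; rewrite ?ler0n //; first lra.
apply: le_trans (_ : ((b m * b m ^ (n %/ m))%N)%:R <= _); first by rewrite ler_nat a_le.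
rewrite natrM ler_wpM2l ?ler0n // natrX -rhom -exprM ler_weXn2l //.
by rewrite mulnC leq_trunc_div.
Qed.

(** As in Fekete's lemma, division of n by m bounds the rate by the m-th root of [b m]. This makes
    the rate finite, and read backwards it is the lower bound on a from which the divergence of the
    series follows. *)
Lemma submult_rate : exists2 l : R, 1 <= l & ratea = l%:E /\
  forall m, l ^+ m <= (a (m + 2 * r))%:R.
Proof.
have le := rate_root (ltn0Sn 0).
have ge : (1 <= ratea)%E by apply: rate_ge1 => n; rewrite ler1n.
case: ratea le ge rate_root => // l le; rewrite lee_fin => l1 root.
exists l => //; split=> // -[|m]; first by rewrite expr0 ler1n.
rewrite -(root_exprK (x := (a (m.+1 + 2 * r))%:R) (n := m.+1)) // lerXn2r ?nnegrE ?powR_ge0 //.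
  lra.
by have := root m.+1 isT; rewrite lee_fin.
Qed.

End Submultiplicative.

(** * Weighted sums over balls and words *)

Section Counting.
Context (R : realType) (G : groupType) (S : finGenSet G).
Implicit Types (A : set G) (g h : G) (s : seq G) (x z : R).
Local Notation d := (wdist S).
Local Notation "`| g |" := (wlen S g) : nat_scope.

Definition ball_fset A n : {fset G} := fset_set (A `&` [set g | (wlen S g <= n)%N]).

Lemma ball_fsetP A n g : reflect (A g /\ (wlen S g <= n)%N) (g \in ball_fset A n).
Proof.
rewrite in_fset_set; last by apply: finite_setIr; exact: finite_ball.
by apply: (iffP idP) => [/set_mem//|[Ag gn]]; apply/mem_set; split.
Qed.

Lemma growthE A n : growth R S A n = #|` ball_fset A n|.
Proof.
rewrite /growth /ball_fset; congr (#|` fset_set (_ `&` _)|).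
by apply/seteqP; split=> g /=; rewrite mdist_vertex ler_nat.
Qed.

Lemma ball_fset_sub A A' n m : A `<=` A' -> (n <= m)%N ->
  (ball_fset A n `<=` ball_fset A' m)%fset.
Proof.
move=> AA nm; apply/fsubsetP => g /ball_fsetP[Ag gn]; apply/ball_fsetP.
by split; [exact: AA|exact: leq_trans nm].
Qed.

Lemma ball_fset_unbounded A N : infinite_set A ->
  exists n0, forall n, (n0 <= n)%N -> (N <= #|` ball_fset A n|)%N.
Proof.
move=> /(infinite_set_fset N)[F FA NF].
exists (\max_(h <- F) wlen S h)%N => n Fn; apply: leq_trans NF _.
apply: fsubset_leq_card; apply/fsubsetP => h hF; apply/ball_fsetP; split; first exact: FA.
by apply: leq_trans Fn; apply: (@leq_bigmax_seq _ (enum_fset F) xpredT (wlen S)).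
Qed.

Lemma sum_sub_fset (F : G -> R) (B B' : {fset G}) : (B `<=` B')%fset ->
  \sum_(h <- B') F h = \sum_(h <- B) F h + \sum_(h <- B' | h \notin B) F h.
Proof.
move=> /fsubsetP BB; rewrite (bigID (fun h => h \in B)) /=; congr (_ + _).
rewrite -big_filter; apply: perm_big; apply: uniq_perm.
- by rewrite filter_uniq // fset_uniq.
- exact: fset_uniq.
- by move=> h; rewrite mem_filter; case: (boolP (h \in B)) => //= /BB.
Qed.

(** Let c = l^(-2r). If the sums were bounded, the weight outside some ball of radius n0 would be at
    most c/2. Elements of length at most n weigh at least l^(-n), so [a n] would be at most [a n0] +
    (c/2) l^n, hence at most [a n0] + [a n] / 2 by the lower bound c l^n on [a n]. Then [a n] would
    stay below twice [a n0], although A is infinite. *)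
Lemma sum_ball_unbounded A (l : R) r B : 1 <= l ->
  (forall m, l ^+ m <= (#|` ball_fset A (m + 2 * r)|)%:R) -> infinite_set A ->
  exists n, B <= \sum_(h <- ball_fset A n) l^-1 ^+ wlen S h.
Proof.
move=> l1 al inf; apply: contrapT => no.
pose a n := #|` ball_fset A n|; pose F h := l^-1 ^+ wlen S h.
pose T n := \sum_(h <- ball_fset A n) F h.
have l0 : 0 < l by lra.
have F0 h : 0 <= F h by rewrite exprn_ge0 // invr_ge0 ltW.
have TB n : T n <= B.
  by have [//|/ltW Bn] := leP (T n) B; case: no; exists n.
pose c := l^-1 ^+ (2 * r); have c0 : 0 < c by rewrite exprn_gt0 // invr_gt0.
have Tsup : has_sup (range T).
  by split; [exists (T 0%N), 0%N|exists B => _ [n _ <-]].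
have c20 : 0 < c / 2 by lra.
have [_ [n0 _ <-] Tn0] := sup_adherent c20 Tsup.
have bound n : (n0 <= n)%N -> (a n)%:R <= (a n0)%:R + c / 2 * l ^+ n.
  move=> n0n; have sub := ball_fset_sub (subset_refl (A := A)) n0n.
  have cardE k : (a k)%:R = \sum_(h <- ball_fset A k) 1 :> R.
    by rewrite big_const_seq count_predT iter_addr addr0.
  rewrite !cardE (sum_sub_fset _ sub) lerD2l.
  have := sum_sub_fset F sub; rewrite -!/(T _) => TE.
  have Tn : T n <= sup (range T) by apply: ub_le_sup; [exact: Tsup.2|exists n].
  have {}TE : \sum_(h <- ball_fset A n | h \notin ball_fset A n0) F h <= c / 2 by lra.
  apply: le_trans (_ : l ^+ n * (\sum_(h <- ball_fset A n | h \notin ball_fset A n0) F h) <= _).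
    rewrite mulr_sumr big_seq_cond [leRHS]big_seq_cond.
    apply: ler_sum => h /andP[/ball_fsetP[_ hn] _].
    rewrite /F exprVn -ler_pdivrMr ?invr_gt0 ?exprn_gt0 // invrK mul1r.
    by rewrite ler_weXn2l.
  by rewrite mulrC ler_wpM2r // exprn_ge0 // ltW.
have [n1 n1P] := ball_fset_unbounded (2 * a n0).+1 inf.
pose n := (n0 + n1 + 2 * r)%N.
have := n1P n; rewrite -/(a n) => /(_ _) aN.
have {}aN : ((2 * a n0).+1 <= a n)%N by apply: aN; rewrite /n; lia.
have an := bound n; have {}an : (a n)%:R <= (a n0)%:R + c / 2 * l ^+ n by apply: an; rewrite /n; lia.
have := al (n - 2 * r)%N; rewrite subnK; last by rewrite /n; lia.
rewrite -/(a n) => aln.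
have ln : c * l ^+ n = l ^+ (n - 2 * r).
  rewrite -[in LHS](@subnKC (2 * r) n); last by rewrite /n; lia.
  by rewrite exprD mulrA /c -exprMn mulVf ?expr1n ?mul1r // gt_eqF.
have : (2 * a n0).+1%:R <= (a n)%:R :> R by rewrite ler_nat.
rewrite -addn1 natrD natrM; lra.
Qed.

Lemma card_near a s C : uniq s -> (forall h, h \in s -> (d a h <= C)%N) ->
  (size s <= #|` ball_fset setT C|)%N.
Proof.
move=> us sC; rewrite -(size_map (fun h => a^-1 * h)%g) -[leqRHS]/(size _).
apply: uniq_leq_size; first by rewrite map_inj_uniq //; exact: mulgI.
by move=> _ /mapP[h hs ->]; apply/ball_fsetP; rewrite -wdistE; split=> //; exact: sC.
Qed.

(** Greedy choice: a is kept and all letters within C of it are discarded. There are at most as many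
    of these as elements in a ball of radius C, and each weighs at most x^(-C) times the weight of
    a. *)
Lemma separated_subseq s C x : 0 <= x -> x <= 1 -> uniq s -> exists s',
  [/\ {subset s' <= s}, uniq s',
      forall h h', h \in s' -> h' \in s' -> (d h h' <= C)%N -> h = h' &
      x ^+ C * \sum_(h <- s) x ^+ wlen S h <=
      (#|` ball_fset setT C|)%:R * \sum_(h <- s') x ^+ wlen S h].
Proof.
move=> x0 x1; have [n] := ubnP (size s); elim: n s => // n IH [|a s] sn us.
  by exists [::]; rewrite !big_nil !mulr0.
pose near h := (d a h <= C)%N.
have [||s' [s's us' sep le]] := IH [seq h <- s | ~~ near h].
- by rewrite size_filter; apply: leq_ltn_trans (count_size _ _) _; rewrite -ltnS.
- by rewrite filter_uniq //; case/andP: us.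
have far h : h \in s' -> h \in s /\ ~~ near h.
  by move=> /s's; rewrite mem_filter => /andP[-> ->].
exists (a :: s'); split.
- by move=> h; rewrite !inE => /orP[->//|/far[-> _]]; rewrite orbT.
- rewrite /= us' andbT; apply/negP => /far[_]; by rewrite /near wdistxx.
- move=> h h'; rewrite !inE => /orP[/eqP->|hs'] /orP[/eqP->|hs''] //.
  + by move=> dC; case: (far _ hs'') => _ /negP[].
  + by rewrite wdist_sym => dC; case: (far _ hs') => _ /negP[].
  + exact: sep.
have -> : \sum_(h <- a :: s) x ^+ wlen S h =
    \sum_(h <- a :: [seq h <- s | near h]) x ^+ wlen S h +
    \sum_(h <- [seq h <- s | ~~ near h]) x ^+ wlen S h.
  by rewrite big_cons (bigID near) /= addrA !big_cons !big_filter.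
rewrite mulrDr [X in _ <= _ * X]big_cons mulrDr; apply: lerD => //.
rewrite mulr_sumr.
have us'' : uniq (a :: [seq h <- s | near h]).
  rewrite /= filter_uniq; last by case/andP: us.
  by rewrite mem_filter negb_and; case/andP: us => -> _; rewrite orbT.
have nearP h : h \in a :: [seq h <- s | near h] -> (d a h <= C)%N.
  by rewrite inE mem_filter => /orP[/eqP->|/andP[]//]; rewrite wdistxx.
apply: (@le_trans _ _ (\sum_(h <- a :: [seq h <- s | near h]) x ^+ wlen S a)).
  rewrite big_seq [leRHS]big_seq; apply: ler_sum => h /nearP dh.
  rewrite -exprD; apply: ler_wiXn2l => //.
  have := wdist_triangle S h 1%g a; rewrite (wdist_sym S h a) -!/(wlen S _); lia.
rewrite big_const_seq count_predT iter_addr addr0 -[leLHS]mulr_natl ler_wpM2r ?exprn_ge0 //.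
by rewrite ler_nat; exact: card_near us'' nearP.
Qed.

(** The sum is grouped by length; each sphere is bounded by its ball, and a geometric series of
    ratio [mu * z] remains. *)
Lemma sum_growth (s : seq G) (mu z K : R) : uniq s -> 0 <= z -> 0 <= mu -> mu * z < 1 ->
  (forall n, (#|` ball_fset setT n|)%:R <= K * mu ^+ n) ->
  \sum_(h <- s) z ^+ wlen S h <= K / (1 - mu * z).
Proof.
move=> us z0 mu0 muz gr.
pose N := (\max_(h <- s) wlen S h).+1%N.
have K0 : 0 <= K by have := gr 0%N; rewrite expr0 mulr1; apply: le_trans.
have -> : \sum_(h <- s) z ^+ wlen S h = \sum_(h <- s) \sum_(i < N | wlen S h == i) z ^+ i.
  rewrite big_seq [RHS]big_seq; apply: eq_bigr => h hs.
  have hN : (wlen S h < N)%N by rewrite ltnS; apply: (@leq_bigmax_seq _ s xpredT (wlen S)).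
  rewrite (bigD1 (Ordinal hN)) //= big1 ?addr0 // => i /andP[/eqP hi].
  by rewrite -val_eqE /= hi eqxx.
rewrite (exchange_big_dep xpredT) //=.
apply: (@le_trans _ _ (\sum_(i < N) K * (mu * z) ^+ i)).
  apply: ler_sum => i _; rewrite big_const_seq iter_addr addr0 -[leLHS]mulr_natl.
  rewrite exprMn mulrA ler_wpM2r ?exprn_ge0 //; apply: le_trans (gr i); rewrite ler_nat.
  rewrite -size_filter; apply: (card_near (a := 1%g)); first exact: filter_uniq.
  by move=> h; rewrite mem_filter => /andP[/eqP hi _]; rewrite -[d _ _]/(wlen S h) hi.
rewrite -mulr_sumr ler_wpM2l // -div1r ler_pdivlMr ?subr_gt0 //.
have := subrX1 (mu * z) N; have : 0 <= (mu * z) ^+ N by rewrite exprn_ge0 // mulr_ge0.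
set q := \sum_(i < N) _; rewrite mulrBl mul1r mulrC => q0 qE; lra.
Qed.

Fixpoint words k s : seq (seq G) :=
  if k is k'.+1 then [seq h :: w | h <- s, w <- words k' s] else [:: [::]].

Lemma mem_words k s w : w \in words k s -> size w = k /\ {subset w <= s}.
Proof.
elim: k w => [|k IH] w /=; first by rewrite inE => /eqP->.
case/allpairsP=> -[h v] /= [hs /IH[vk vs] ->]; split; first by rewrite /= vk.
by move=> h'; rewrite inE => /orP[/eqP->//|/vs].
Qed.

Lemma words_uniq k s : uniq s -> uniq (words k s).
Proof.
move=> us; elim: k => [//|k IH] /=; apply: allpairs_uniq => //.
by move=> [h w] [h' w'] _ _ /= [-> ->].
Qed.

Lemma sum_words (F : G -> R) k s :
  \sum_(w <- words k s) \prod_(h <- w) F h = (\sum_(h <- s) F h) ^+ k.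
Proof.
elim: k => [|k IH] /=; first by rewrite big_seq1 big_nil expr0.
rewrite big_allpairs_dep exprS mulr_suml; apply: eq_bigr => h _.
by rewrite -IH mulr_sumr; apply: eq_bigr => w _; rewrite big_cons.
Qed.

End Counting.

(** * The strict growth inequality *)

Section Gap.
Context (R : realType) (G : groupType) (S : finGenSet G) (H : groupClosed G).
Implicit Types (g h : G) (w s : seq G) (x z : R).
Local Notation d := (wdist S).
Local Notation B A n := (ball_fset S A n).

(** The path from 1 to h is cut at time n. Near the cut there is an element k of H, and h is the
    product of k and [k^-1 * h], whose lengths exceed n and m by at most r + 2. *)
Lemma stable_growth_submult N r alpha : stable_paths S H N r alpha ->
  exists r', forall n m,
    (#|` B [set` H] (n + m)| <= #|` B [set` H] (n + r')| * #|` B [set` H] (m + r')|)%N.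
Proof.
move=> st; exists (r + 2)%N => n m; rewrite -(size_allpairs (fun u v => u * v)%g).
apply: uniq_leq_size; first exact: fset_uniq.
move=> h /ball_fsetP[/= hH hnm].
pose i := minn n (wlen S h); have ih : (i <= wlen S h)%N by rewrite /i; lia.
have [k kH dk] := alpha_near st 1%g hH ih.
have ni : (i <= n)%N by rewrite /i; lia.
have mi : (wlen S h - i <= m)%N by rewrite /i; lia.
have l1 := alpha_dist0_le st 1%g hH ih; have l2 := alpha_distn_le st 1%g hH ih.
rewrite !mul1g in dk l1 l2.
apply/allpairsP; exists (k, k^-1 * h)%g; rewrite /= mulVKg.
split=> //; apply/ball_fsetP; split => //=.
- have := wdist_triangle S (alpha h i) 1%g k; rewrite -/(wlen S k); lia.
- by apply: gpredM => //; rewrite gpredV.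
rewrite -wdistE; have := wdist_triangle S (alpha h i) k h.
by rewrite (wdist_sym S k (alpha h i)); lia.
Qed.

Lemma word_val_weight g z w : 0 <= z -> z <= 1 ->
  \prod_(h <- w) z ^+ (wlen S h + wlen S g) <= z ^+ wlen S (word_val g w).
Proof.
move=> z0 z1; elim: w => [|h w IH]; first by rewrite big_nil /wlen wdistxx expr0.
rewrite big_cons /=; apply: le_trans (_ : z ^+ (wlen S h + wlen S g + wlen S (word_val g w)) <= _).
  by rewrite [leRHS]exprD ler_wpM2l // exprn_ge0.
apply: ler_wiXn2l => //; apply: leq_trans (wlenM _ _ _) _.
by rewrite leq_add2r; exact: wlenM.
Qed.

(** Equal values force close first letters, which coincide by separation; they cancel and the
    induction goes on. *)
Lemma word_val_inj g L C s k :
  (forall h w h' w', long_letters S H L (h :: w) -> long_letters S H L (h' :: w') ->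
    word_val g (h :: w) = word_val g (h' :: w') -> (d h h' <= C)%N) ->
  long_letters S H L s ->
  (forall h h', h \in s -> h' \in s -> (d h h' <= C)%N -> h = h') ->
  {in words k s &, injective (word_val g)}.
Proof.
move=> close ls sep; elim: k => [|k IH] w w' /=.
  by rewrite !inE => /eqP-> /eqP->.
case/allpairsP=> -[h v] /= [hs vk ->]; case/allpairsP=> -[h' v'] /= [hs' vk' ->] e.
have long h0 v0 : h0 \in s -> v0 \in words k s -> long_letters S H L (h0 :: v0).
  by move=> h0s /mem_words[_ v0s] h1; rewrite inE => /orP[/eqP->|/v0s]; exact: ls.
have hh' : h = h'.
  by apply: sep => //; apply: close (long _ _ hs vk) (long _ _ hs' vk') e.
rewrite hh'; congr (_ :: _); apply: IH => //.
by move: e => /=; rewrite hh' => /mulgI.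
Qed.

(* Words in a finite separated set of letters inject into G; when the weights
   z ^ (|h| + |g|) of the letters sum to at least 2, the words of length k have
   total weight at least 2 ^ k, while G has finite total weight for z mu < 1. *)
Lemma words_growth_contra g s (mu z K : R) : 0 <= z -> z <= 1 -> 0 <= mu -> mu * z < 1 ->
  (forall n, (#|` B setT n|)%:R <= K * mu ^+ n) -> uniq s ->
  (forall k, {in words k s &, injective (word_val g)}) ->
  2 <= \sum_(h <- s) z ^+ (wlen S h + wlen S g) -> False.
Proof.
move=> z0 z1 mu0 muz gr us inj two.
have bound k : 2 ^+ k <= K / (1 - mu * z).
  apply: (@le_trans _ _ ((\sum_(h <- s) z ^+ (wlen S h + wlen S g)) ^+ k)).
    by rewrite lerXn2r // nnegrE; lra.
  rewrite -sum_words; apply: (@le_trans _ _ (\sum_(h <- map (word_val g) (words k s)) z ^+ wlen S h)).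
    by rewrite big_map; apply: ler_sum => w _; exact: word_val_weight.
  apply: sum_growth => //; rewrite map_inj_in_uniq ?words_uniq //; exact: inj.
have [|n /(_ n (leqnn n))] := @expr_unbounded R 2 (K / (1 - mu * z) + 1); first lra.
have := bound n; lra.
Qed.

(** The strict inequality comes from finiteness of the letter set: lowering the base 1/l slightly
    keeps half of the total weight, which leaves room to raise l slightly as well. *)
Lemma growth_gap g L C r (l : R) : 1 <= l ->
  (forall m, l ^+ m <= (#|` B [set` H] (m + 2 * r)|)%:R) -> infinite_set [set` H] ->
  (forall h w h' w', long_letters S H L (h :: w) -> long_letters S H L (h' :: w') ->
    word_val g (h :: w) = word_val g (h' :: w') -> (d h h' <= C)%N) ->
  (l%:E < rate (fun n => (#|` B setT n|)%:R : R))%E.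
Proof.
move=> l1 lH inf close; rewrite ltNge; apply/negP => rl.
have l0 : 0 < l by lra.
pose x := l^-1; have x0 : 0 < x by rewrite invr_gt0.
have x1 : x <= 1 by rewrite invf_le1.
pose P := (#|` B setT C|)%:R : R.
pose short := (#|` B [set` H] L|)%:R : R.
have xgC : 0 < x ^+ (wlen S g) * x ^+ C by rewrite mulr_gt0 // exprn_gt0.
(* The threshold allows for the losses to come: discarding the letters shorter than L, passing to a
   separated subset, and the factor x^|g| of each letter. A weight of at least 4 remains. *)
have [n nB] := sum_ball_unbounded (4 * P / (x ^+ (wlen S g) * x ^+ C) + short) l1 lH inf.
rewrite -/x in nB.
have P1 : 0 < P.
  rewrite ltr0n cardfs_gt0; apply/fset0Pn; exists 1%g; apply/ball_fsetP.
  by rewrite /wlen wdistxx.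
pose s0 := [seq h <- B [set` H] n | (L <= wlen S h)%N].
have [|s [ss us sep le]] := separated_subseq S C (ltW x0) x1 (s := s0).
  by rewrite filter_uniq // fset_uniq.
have ls : long_letters S H L s.
  by move=> h /ss; rewrite mem_filter => /andP[Lh /ball_fsetP[]].
have short_le : \sum_(h <- B [set` H] n | ~~ (L <= wlen S h)%N) x ^+ wlen S h <= short.
  apply: (@le_trans _ _ (\sum_(h <- B [set` H] n | ~~ (L <= wlen S h)%N) 1)).
    by apply: ler_sum => h _; rewrite exprn_ile1 // ltW.
  rewrite big_const_seq iter_addr addr0 ler_nat -size_filter -[leqRHS]/(size _).
  apply: uniq_leq_size; first by rewrite filter_uniq // fset_uniq.
  move=> h; rewrite mem_filter -ltnNge => /andP[hL /ball_fsetP[hH _]].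
  by apply/ball_fsetP; split => //; exact: ltnW.
have s4 : 4 <= \sum_(h <- s) x ^+ (wlen S h + wlen S g).
  under eq_bigr do rewrite exprD.
  rewrite -mulr_suml -(ler_pM2l P1) mulrA.
  have : 4 * P / (x ^+ (wlen S g) * x ^+ C) <= \sum_(h <- s0) x ^+ wlen S h.
    by rewrite big_filter; move: nB; rewrite (bigID (fun h => L <= wlen S h)%N) /=; lra.
  rewrite ler_pdivrMr // => s4.
  have g0 : 0 <= x ^+ wlen S g by rewrite exprn_ge0 // ltW.
  by have := ler_wpM2r g0 le; rewrite -/P; lra.
(* All exponents are at most E, and by Bernoulli's inequality (1 - e)^(E + 1) is at least 1/2, so
   replacing x by z at most halves the weight. *)
pose E := (n + wlen S g)%N; pose e : R := (2 * E.+1%:R)^-1.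
have E0 : 0 < E.+1%:R :> R by rewrite ltr0n.
have e0 : 0 < e by rewrite invr_gt0; lra.
have E1 : 1 <= E.+1%:R :> R by rewrite ler1n.
have eE : E.+1%:R * e = 2^-1 by rewrite /e invfM mulrCA mulfV ?mulr1 // gt_eqF.
have e1 : e <= 2^-1 by rewrite -eE ler_peMl // ltW.
pose z := x * (1 - e).
have z0 : 0 <= z by rewrite mulr_ge0 ?(ltW x0) //; lra.
have z1 : z <= 1 by rewrite mulr_ile1 ?(ltW x0) //; lra.
have s2 : 2 <= \sum_(h <- s) z ^+ (wlen S h + wlen S g).
  apply: (@le_trans _ _ (2^-1 * \sum_(h <- s) x ^+ (wlen S h + wlen S g))); first lra.
  rewrite mulr_sumr big_seq [leRHS]big_seq; apply: ler_sum => h /ss.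
  rewrite mem_filter => /andP[_ /ball_fsetP[_ hn]].
  rewrite /z exprMn mulrC ler_wpM2l ?exprn_ge0 ?(ltW x0) //.
  apply: (@le_trans _ _ ((1 - e) ^+ E.+1)).
    have := @bernoulli R (- e) E.+1; rewrite mulrN eE; lra.
  apply: ler_wiXn2l; [lra|lra|].
  by apply: leq_trans (leqnSn _); rewrite leq_add2r.
(* Then [mu * z] equals 1 - e^2, while mu still exceeds the rate of G. *)
pose mu := l * (1 + e).
have mu1 : 1 <= mu by rewrite /mu mulr_ege1 //; lra.
have muz : mu * z < 1.
  have -> : mu * z = (l * x) * (1 - e * e) by rewrite /mu /z; ring.
  by rewrite mulfV ?gt_eqF // mul1r; have := mulr_gt0 e0 e0; lra.
have lmu : (rate (fun n => (#|` B setT n|)%:R : R) < mu%:E)%E.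
  apply: le_lt_trans rl _; rewrite lte_fin /mu; have := mulr_gt0 l0 e0; lra.
have [|n0 gr] := rate_lt _ lmu; first by move=> m; exact: ler0n.
have mu0 : 0 <= mu by lra.
(* The bound mu^m holds from n0 on; the size of the ball of radius n0 in the constant takes care of
   the smaller radii. *)
apply: (@words_growth_contra g s mu z (1 + (#|` B setT n0|)%:R)) => //; last first.
  by move=> k; exact: word_val_inj close ls sep.
move=> m; have pm : 1 <= mu ^+ m by exact: exprn_ege1.
have [nm|/ltnW mn] := leqP n0 m.
  apply: le_trans (gr m nm) _; rewrite ler_peMl ?exprn_ge0 //.
  by rewrite lerDl.
apply: (@le_trans _ _ (#|` B setT n0|)%:R).
  by rewrite ler_nat; apply: fsubset_leq_card; exact: ball_fset_sub.
rewrite -[leLHS]mulr1; apply: ler_pM => //; lra.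
Qed.

End Gap.

Theorem theorem1p8 (R : realType) (G : groupType) (S : finGenSet G)
    (H : groupClosed G) :
  has_MLTG R G ->
  stable R S H -> infinite_set [set` H] -> infinite_index H ->
  (growth_rate R S [set` H] < growth_rate R S [set: G])%E.
Proof.
move=> [T mltg] stH infH indH.
have ltg : local_to_global S.
  by apply: (@local_to_global_gens _ _ T); exact: MLTG_local_to_global mltg.
have [N [r [alpha st]]] := stable_stable_paths stH.
have [g [K transverse]] := exists_transverse st indH.
have [L [C close]] := first_letter_close st transverse ltg.
have [r' sub] := stable_growth_submult st.
have growth_rateE A : growth_rate R S A = rate (fun n => (#|` ball_fset S A n|)%:R : R).
  by rewrite /growth_rate /rate; under eq_fun do rewrite growthE.
have [||l l1 [lE lH]] := @submult_rate R (fun n => #|` ball_fset S [set` H] n|) r' _ _ sub.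
- move=> n; rewrite cardfs_gt0; apply/fset0Pn; exists 1%g; apply/ball_fsetP.
  by rewrite /wlen wdistxx /= gpred1.
- by move=> n m nm; apply: fsubset_leq_card; exact: ball_fset_sub.
by rewrite !growth_rateE lE; exact: growth_gap l1 lH infH close.
Qed.
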